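(* Let $\tau\in(0,1)$ and $F>0$ be fixed, let $x_1,\dots,x_n\in\mathbb{R}^d$ be fixed design points, and let $y_1,\dots,y_n$ be real random variables that are independent (conditionally on the design). Let $F_{y_i|x_i}$ and $p_{y_i|x_i}$ be the cumulative distribution function and the probability density function of $y_i$ conditioning on $x_i$, and let $f_\tau^*(x_i)=F_{y_i|x_i}^{-1}(\tau)$ for $i=1,\dots,n$. Assume that there are constants $L_0>0$, $\underline{p}>0$, $c>0$ such that for every $\delta\in\mathbb{R}^n$ with $\|\delta\|_\infty\le L_0$, $$\min_{i=1,\dots,n} p_{y_i|x_i}\big(f_\tau^*(x_i)+\delta_i\big)\ge \underline{p},$$ and $\sup_{t\in\mathbb{R}}p_{y_i|x_i}(t)\le c$ almost surely for all $i$. Let $\mathcal{F}(W,U,L)$ be the class of ReLU networks with $W$ parameters, $U$ nodes and $L$ layers, and let $$\hat f\in\arg\min_{f\in\mathcal{F}(W,U,L),\ \|f\|_\infty\le F}\ \sum_{i=1}^n\rho_\tau(y_i-f(x_i)).$$ Then there are constants $C>0$ and $c_1>0$, not depending on $n,W,U,L$, such that whenever $n\ge C\,LW\log(U)$, $$\mathbb{E}\left[\Delta_n^2(f_\tau^*,\hat f)\,\big|\,x_1,\dots,x_n\right]\le c_1F\left[\frac{LW\log U\cdot\log n}{n}\right]^{1/2}+c_1\,\mathrm{err}_1 ,$$ and furthermore $$\mathbb{E}\left[\|\hat f-f_\tau^*\|_n^2\,\big|\,x_1,\dots,x_n\right]\le c_1\max\{1,F\}F\left[\frac{LW\log U\cdot\log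 n}{n}\right]^{1/2}+c_1\max\{1,F\}\,\mathrm{err}_1 .$$
   Context: Quantile loss: $\rho_\tau(x)=\max\{\tau x,(\tau-1)x\}$. ReLU networks: let $\phi(x)=\max\{x,0\}$ and, for $v\in\mathbb{R}^r$, let $\phi_v:\mathbb{R}^r\to\mathbb{R}^r$, $\phi_v(a)=(\phi(a_1-v_1),\dots,\phi(a_r-v_r))^\top$. The networks considered are functions $f:\mathbb{R}^{p_0}\to\mathbb{R}^{p_{L+1}}$ of the form $$f(x)=A^{(L)}\phi_{V_L}\circ A^{(L-1)}\phi_{V_{L-1}}\circ\cdots\circ A^{(1)}\phi_{V_1}\circ A^{(0)}x,$$ with $A^{(i)}\in\mathbb{R}^{p_{i+1}\times p_i}$, $V_i\in\mathbb{R}^{p_i}$, $p_0=d$ and $p_{L+1}=1$. $L$ is the number of layers. $\mathcal{F}(W,U,L)$ is the class of networks of this form such that the number of parameters is $W$, the number of nodes is $U$ and the number of layers is $L$. $\|f\|_\infty$ is the supremum norm of $f$. Losses: $D^2(t)=\min\{|t|,t^2\}$, $\Delta_n^2(f,g)=\frac1n\sum_{i=1}^nD^2(f(x_i)-g(x_i))$, and $\|f-g\|_n^2=\frac1n\sum_{i=1}^n(f(x_i)-g(x_i))^2$. Approximation error: let $z\in\mathbb{R}^n$ be an independent copy of $y=(y_1,\dots,y_n)$, and let $$f_n\in\arg\min_{f\in\mathcal{F}(W,U,L),\ \|f\|_\infty\le F}\mathbb{E}\left[\sum_{i=1}^n\rho_\tau(z_i-f(x_i))-\sum_{i=1}^n\rho_\tau(z_i-f_\tau^*(x_i))\right],$$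 $$\mathrm{err}_1=\mathbb{E}\left[\frac1n\sum_{i=1}^n\rho_\tau(z_i-f_n(x_i))-\frac1n\sum_{i=1}^n\rho_\tau(z_i-f_\tau^*(x_i))\right].$$
   Formalization: The second inequality (for the squared empirical norm) is stated under the added assumption that |f*_τ(x_i)| ≤ B for all i, with B an arbitrary fixed real on which c_1 may depend; without a bound on f*_τ it fails, e.g. for quantiles f*_τ(x_i)=i and constant networks. *)

(* Defs.v *)
From HB Require Import structures.
From mathcomp Require Import all_boot all_order all_algebra.
From mathcomp Require Import all_classical all_reals all_analysis.

Set Implicit Arguments.
Unset Strict Implicit.
Unset Printing Implicit Defensive.

Import Order.TTheory GRing.Theory Num.Theory.
Import numFieldNormedType.Exports.

Local Open Scope classical_set_scope.
Local Open Scope ring_scope.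

Section losses.
Context {R : realType}.

Definition quantile_loss (tau t : R) : R := Num.max (tau * t) ((tau - 1) * t).

Definition Dsq (t : R) : R := Num.min `|t| (t ^+ 2).

Definition Delta2 (X : Type) n (x : 'I_n -> X) (f g : X -> R) : R :=
  n%:R^-1 * \sum_(i < n) Dsq (f (x i) - g (x i)).

Definition empnorm2 (X : Type) n (x : 'I_n -> X) (f g : X -> R) : R :=
  n%:R^-1 * \sum_(i < n) (f (x i) - g (x i)) ^+ 2.

Definition supnorm (X : Type) (f : X -> R) : \bar R :=
  ereal_sup (range (fun x => `|f x|%:E)).

End losses.

Definition is_argmin (X : Type) (disp : Order.disp_t) (K : porderType disp)
    (S : set X) (obj : X -> K) (m : X) : Prop :=
  S m /\ forall g, S g -> (obj m <= obj g)%O.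

Section networks.
Context {R : realType}.

Definition relu (t : R) : R := Num.max t 0.

Definition shifted_relu r (v a : 'cV[R]_r) : 'cV[R]_r :=
  \col_i relu (a i 0 - v i 0).

(* Networks with input dimension r, read from the input side:
   [Affine_out A] is x |-> A x, and [Hidden A V N] is
   x |-> N (phi_V (A x)). Thus
   Hidden A0 V1 (Hidden A1 V2 (... (Affine_out AL))) is
   AL phi_VL o ... o A1 phi_V1 o A0; hidden widths are positive and the output
   width is 1. Matrices and shifts are unconstrained (no sparsity), so the
   parameter count is the total number of their entries. *)
Inductive network : nat -> Type :=
| Affine_out r of 'M[R]_(1, r) : network r
| Hidden r s of 'M[R]_(s.+1, r) & 'cV[R]_s.+1 & network s.+1 : network r.

Fixpoint eval_net r (N : network r) : 'cV[R]_r -> R :=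
  match N with
  | Affine_out r A => fun x => (A *m x) 0 0
  | Hidden r s A V N' => fun x => eval_net N' (shifted_relu V (A *m x))
  end.

Fixpoint nb_layers r (N : network r) : nat :=
  match N with
  | Affine_out _ _ => 0
  | Hidden _ _ _ _ N' => (nb_layers N').+1
  end.

Fixpoint nb_params r (N : network r) : nat :=
  match N with
  | Affine_out r _ => (1 * r)%N
  | Hidden r s _ _ N' => (s.+1 * r + s.+1 + nb_params N')%N
  end.

(* p_0 + p_1 + ... + p_{L+1}: input, hidden and output nodes. *)
Fixpoint nb_nodes r (N : network r) : nat :=
  match N with
  | Affine_out r _ => (r + 1)%N
  | Hidden r _ _ _ N' => (r + nb_nodes N')%N
  end.

(* The widths p_1, ..., p_L are not fixed: only W, U and L are. *)
Definition relu_class d (W U L : nat) : set ('cV[R]_d -> R) :=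
  [set f | exists N : network d,
     [/\ nb_params N = W, nb_nodes N = U, nb_layers N = L & f = eval_net N]].

Definition bounded_relu_class d (W U L : nat) (F : R) : set ('cV[R]_d -> R) :=
  [set f | relu_class W U L f /\ (supnorm f <= F%:E)%E].

End networks.

Section random_variables.
Context {disp : measure_display} {T : measurableType disp} {R : realType}.
Variable P : probability T R.

Definition mutually_independent n (y : 'I_n -> {RV P >-> R}) : Prop :=
  forall (J : {set 'I_n}) (A : 'I_n -> set R),
    (forall i, measurable (A i)) ->
    P (\bigcap_(i in [set` J]) (y i @^-1` A i)) =
    (\prod_(i in J) P (y i @^-1` A i))%E.

Definition joint n (y : 'I_n -> {RV P >-> R}) (w : T) : n.-tuple R :=
  [tuple y i w | i < n].

Definition independent_copy n (y z : 'I_n -> {RV P >-> R}) : Prop :=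
  (forall A : set (n.-tuple R), measurable A ->
     P (joint z @^-1` A) = P (joint y @^-1` A)) /\
  (forall A B : set (n.-tuple R), measurable A -> measurable B ->
     P (joint y @^-1` A `&` joint z @^-1` B) =
     (P (joint y @^-1` A) * P (joint z @^-1` B))%E).

Definition is_density (X : {RV P >-> R}) (p : R -> R) : Prop :=
  [/\ measurable_fun [set: R] p,
      forall t, 0 <= p t &
      forall A : set R, measurable A ->
        distribution P X A = (\int[lebesgue_measure]_(t in A) (p t)%:E)%E].

(* F^{-1}(tau) as the generalized inverse; the set is nonempty and bounded
   below only for 0 < tau < 1. *)
Definition quantile (X : {RV P >-> R}) (tau : R) : R :=
  inf [set t : R | (tau%:E <= cdf X t)%E].

Definition excess_loss (X : Type) n (x : 'I_n -> X) (tau : R)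
    (z : 'I_n -> {RV P >-> R}) (fstar f : X -> R) (w : T) : R :=
  \sum_(i < n) quantile_loss tau (z i w - f (x i))
  - \sum_(i < n) quantile_loss tau (z i w - fstar (x i)).

Definition err1 (X : Type) n (x : 'I_n -> X) (tau : R)
    (z : 'I_n -> {RV P >-> R}) (fstar fn : X -> R) : \bar R :=
  ('E_P[(fun w =>
    n%:R^-1 * (\sum_(i < n) quantile_loss tau (z i w - fn (x i)))
    - n%:R^-1 * (\sum_(i < n) quantile_loss tau (z i w - fstar (x i))))%R])%E.

End random_variables.

Definition rate {R : realType} (n W U L : nat) : R :=
  Num.sqrt (L%:R * W%:R * ln U%:R * ln n%:R / n%:R).

(* Main.v *)
Require Import Defs.
From HB Require Import structures.
From mathcomp Require Import all_boot all_order all_algebra.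
From mathcomp Require Import all_classical all_reals all_analysis.
From mathcomp Require Import measurable_realfun ring lra zify.
Import Order.TTheory GRing.Theory Num.Theory.
Import numFieldNormedType.Exports.
Local Open Scope classical_set_scope.
Local Open Scope ring_scope.
Set Implicit Arguments.
Unset Strict Implicit.
Unset Printing Implicit Defensive.

(** Three ingredients give the bound.

    Margin. Near the quantile q of y_i the density is at least plow, so the
    expected excess loss E[rho(y_i - v) - rho(y_i - q)] is at least a constant
    times D^2(v - q) ([expected_loss_margin]). Hence Delta_n^2(fstar, fhat) is
    controlled by the expected excess loss of fhat over fstar, which is err1
    plus the expected excess loss of fhat over fn. Only the latter has to be
    compared with its empirical version, and its summands are bounded by 2F
    whatever the size of fstar.

    Capacity. On the n design points, the functions of the class bounded by F
    are covered, within F/n in the maximum norm, by (nU)^(9WL) vectors when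
    n >= 2 and L >= 1 ([network_cover]). The values of a network are piecewise polynomial in its
    W parameters, of degree at most L+1; the pieces are refined layer by layer
    according to the signs of the preactivations, and a last refinement records
    the position of the outputs with respect to a grid of thresholds. Each
    refinement multiplies the number of pieces by the number of realised sign
    patterns of a family of polynomials, which [card_sign_patterns] bounds by
    (2 * family size * degree + 1)^W. This bound comes from counting critical
    points: each sign cell contains a critical point of a function of the form
    eps * sum_i x_i^(K+2) - G(x) with deg G <= K; the critical points solve a
    system x_i^(K+1) = q_i(x) with deg q_i <= K, and such a system has at most
    (K+1)^W solutions by linear algebra ([card_diagonal_solutions]).

    Deviation. For a fixed vector of the cover, the centred empirical excess
    loss is a sum of n independent variables bounded by 4F, so its exponential
    moments are at most exp(2 n (4 F lam)^2) as long as 4 F lam <= 1/2. The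
    usual union bound over the cover gives one integrable random variable that
    dominates the deviations of all its elements ([max_envelope]). With
    lam = rate / (8F) its mean is of order n F rate; when rate > 1 the crude
    bound 2F on the excess loss is enough. *)

(** * Polynomial functions *)

Section PolynomialFunctions.
Context {R : realType} {m : nat}.
Implicit Types (x : 'rV[R]_m.+1) (e : 'I_m.+1 -> nat) (f g : 'rV[R]_m.+1 -> R).

(** Monomials are given by their exponents; [mdeg e] is the total degree. *)
Definition mdeg e : nat := (\sum_i e i)%N.

Definition mon e x : R := \prod_i x 0 i ^+ e i.

(** [polyle D f]: the function f is a polynomial of total degree at most D, as
    an explicit sum of terms a * x^e with mdeg e <= D. *)
Inductive polyle (D : nat) : ('rV[R]_m.+1 -> R) -> Prop :=
| polyle0 : polyle D (fun=> 0)
| polyle_cons (a : R) e f :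
    (mdeg e <= D)%N -> polyle D f -> polyle D (fun x => a * mon e x + f x).

Lemma polyleW D D' f : (D <= D')%N -> polyle D f -> polyle D' f.
Proof.
move=> DD'; elim=> [|a e g eD _ IH]; first exact: polyle0.
by apply: polyle_cons => //; exact: leq_trans DD'.
Qed.

Lemma polyle_mon D a e : (mdeg e <= D)%N -> polyle D (fun x => a * mon e x).
Proof.
move=> eD; have -> : (fun x => a * mon e x) = (fun x => a * mon e x + 0).
  by apply/funext => x; rewrite addr0.
by apply: polyle_cons => //; exact: polyle0.
Qed.

Lemma polyleD D f g :
  polyle D f -> polyle D g -> polyle D (fun x => f x + g x).
Proof.
move=> + gD; elim=> [|a e h eD _ IH].
  by under eq_fun do rewrite add0r.
under eq_fun do rewrite -addrA.
exact: polyle_cons.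
Qed.

Lemma polyleZ D a f : polyle D f -> polyle D (fun x => a * f x).
Proof.
elim=> [|b e h eD _ IH]; first by under eq_fun do rewrite mulr0; exact: polyle0.
under eq_fun do rewrite mulrDr mulrA.
exact: polyle_cons.
Qed.

Lemma polyleN D f : polyle D f -> polyle D (fun x => - f x).
Proof. by move=> /(polyleZ (-1)); under eq_fun do rewrite mulN1r. Qed.

Lemma monM e e' x : mon e x * mon e' x = mon (fun i => e i + e' i)%N x.
Proof. by rewrite /mon -big_split; apply: eq_bigr => i _; rewrite exprD. Qed.

Lemma mdegD e e' : mdeg (fun i => e i + e' i)%N = (mdeg e + mdeg e')%N.
Proof. by rewrite /mdeg big_split. Qed.

Lemma polyleM D D' f g :
  polyle D f -> polyle D' g -> polyle (D + D') (fun x => f x * g x).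
Proof.
move=> + gD; elim=> [|a e h eD _ IH].
  by under eq_fun do rewrite mul0r; exact: polyle0.
under eq_fun do rewrite mulrDl.
apply: polyleD => //.
elim: gD => [|b e' h' e'D _ IH'].
  by under eq_fun do rewrite mulr0; exact: polyle0.
under eq_fun do rewrite mulrDr.
apply: polyleD => //.
under eq_fun do rewrite mulrACA monM.
by apply: polyle_mon; rewrite mdegD leq_add.
Qed.

Lemma polyle_cst D a : polyle D (fun=> a).
Proof.
have -> : (fun=> a) = (fun x => a * mon (fun=> 0%N) x).
  by apply/funext => x; rewrite /mon big1 ?mulr1.
by apply: polyle_mon; rewrite /mdeg big1.
Qed.

Lemma polyle_coordX n i : polyle n (fun x => x 0 i ^+ n).
Proof.
have -> : (fun x => x 0 i ^+ n) = (fun x => 1 * mon (fun j => (j == i) * n)%N x).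
  apply/funext => x; rewrite /mon (bigD1 i)//= eqxx mul1n mul1r big1 ?mulr1//.
  by move=> j /negPf ->; rewrite expr0.
apply: polyle_mon.
rewrite /mdeg (bigD1 i)//= eqxx mul1n big1 ?addn0//.
by move=> j /negPf ->.
Qed.

Lemma polyle_coord i : polyle 1 (fun x => x 0 i).
Proof. exact: (polyle_coordX 1 i). Qed.

Lemma polyle_sum (I : Type) (s : seq I) D (f : I -> 'rV[R]_m.+1 -> R) :
  (forall i, polyle D (f i)) -> polyle D (fun x => \sum_(i <- s) f i x).
Proof.
move=> fD; elim: s => [|i s IH].
  by under eq_fun do rewrite big_nil; exact: polyle0.
by under eq_fun do rewrite big_cons; exact: polyleD.
Qed.

Lemma polyle_prod (I : Type) (s : seq I) D (f : I -> 'rV[R]_m.+1 -> R) :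
  (forall i, polyle D (f i)) -> polyle (size s * D) (fun x => \prod_(i <- s) f i x).
Proof.
move=> fD; elim: s => [|i s IH].
  by under eq_fun do rewrite big_nil; exact: polyle_cst.
by under eq_fun do rewrite big_cons; rewrite /= mulSn; exact: polyleM.
Qed.

Lemma continuous_coordX n i : continuous (fun x : 'rV[R]_m.+1 => x 0 i ^+ n).
Proof.
move=> x; apply: (cvg_comp (fun y : 'rV[R]_m.+1 => y 0 i) (fun t => t ^+ n)).
  exact: coord_continuous.
exact: exprn_continuous.
Qed.

Lemma continuous_mon e : continuous (mon e).
Proof.
rewrite /mon; elim: (index_enum _) => [|i s IH] x.
  by under eq_fun do rewrite big_nil; apply: cst_continuous.
under eq_fun do rewrite big_cons.
exact: (continuousM (@continuous_coordX (e i) i x) (IH x)).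
Qed.

Lemma polyle_continuous D f : polyle D f -> continuous f.
Proof.
elim=> [|a e g _ _ IH] x; first by apply: cst_continuous.
have cm := continuousM (@cst_continuous _ _ a x) (@continuous_mon e x).
exact: (continuousD cm (IH x)).
Qed.

(** A polynomial of degree at most D is O(r^D) on the cube of half-side r >= 1. *)
Lemma polyle_growth D f : polyle D f ->
  exists K, 0 <= K /\ forall r x, 1 <= r -> (forall i, `|x 0 i| <= r) ->
    `|f x| <= K * r ^+ D.
Proof.
elim=> [|a e g eD _ [K [K0 IH]]].
  by exists 0; split => // r x _ _; rewrite normr0 mul0r.
exists (`|a| + K); split=> [|r x r1 xr]; first by rewrite addr_ge0.
rewrite (le_trans (ler_normD _ _))// mulrDl lerD// ?IH// normrM.
rewrite ler_wpM2l// (@le_trans _ _ (r ^+ mdeg e))//; last by rewrite ler_weXn2l.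
rewrite /mon normr_prod /mdeg -prodrXr ler_prod// => i _.
by rewrite normrX exprn_ge0//= lerXn2r// nnegrE// (le_trans ler01).
Qed.

(** The partial derivative of a polynomial function is one of no larger degree. *)
Lemma polyle_derive D f i : polyle D f ->
  exists2 f', polyle D f' & forall x t,
    is_derive (t : R) 1 (fun s => f (x + s *: delta_mx 0 i)) (f' (x + t *: delta_mx 0 i)).
Proof.
elim=> [|a e g eD _ [g' g'D IH]].
  by exists (fun=> 0); [exact: polyle0|move=> x t; exact: is_derive_cst].
exists (fun x => a * (e i)%:R * mon (fun j => e j - (j == i))%N x + g' x).
  apply: polyle_cons => //.
  by rewrite (leq_trans _ eD)// /mdeg leq_sum// => j _; rewrite leq_subr.
move=> x t.
set c := \prod_(j | j != i) x 0 j ^+ e j.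
have E (e' : 'I_m.+1 -> nat) s : (forall j, j != i -> e' j = e j) ->
    mon e' (x + s *: delta_mx 0 i) = (x 0 i + s) ^+ e' i * c.
  move=> e'e; rewrite /mon (bigD1 i)//= !mxE !eqxx mulr1; congr (_ * _).
  by apply: eq_bigr => j ji; rewrite e'e// !mxE (negPf ji) andbF mulr0 addr0.
have -> : (fun s => a * mon e (x + s *: delta_mx 0 i) + g (x + s *: delta_mx 0 i)) =
  (fun s => a * c * (x 0 i + s) ^+ e i) + (fun s => g (x + s *: delta_mx 0 i)).
  by apply/funext => s; rewrite fctE E// mulrA [in RHS]mulrAC.
apply: is_deriveD.
rewrite E => [|j /negPf ->]; last by rewrite subn0.
rewrite eqxx subn1.
have d1 : is_derive t 1 (fun s => x 0 i + s) 1.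
  have := is_deriveD (is_derive_cst (x 0 i) t 1) (is_derive_id t 1).
  by rewrite add0r.
have dX := is_deriveX (e i) d1.
have := is_deriveZ (a * c) dX.
rewrite /GRing.scale/= => H.
have -> : a * (e i)%:R * ((x 0 i + t) ^+ (e i).-1 * c) =
  a * c * ((e i)%:R * (x 0 i + t) ^+ (e i).-1 * 1) by ring.
have -> : (fun s => a * c * (x 0 i + s) ^+ e i) = (a * c) \*: (+%R (x 0 i)) ^+ e i.
  by apply/funext => s; rewrite /= /GRing.scale/= fctE.
exact: H.
Qed.
End PolynomialFunctions.

(** * Systems x_i^(M+1) = q_i(x) *)

Section DiagonalSystems.
Context {R : realType} {m : nat}.

(** Reduction modulo x_i^(M+1) = q_i(x): each monomial restricted to the
    solutions is a combination of the monomials with all exponents at most M,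
    so the (M+1)^(number of variables) such monomials span all functions on
    the solution set. *)
Lemma card_diagonal_solutions N (z : 'I_N -> 'rV[R]_m.+1) M
    (q : 'I_m.+1 -> 'rV[R]_m.+1 -> R) :
  injective z -> (forall i, polyle M (q i)) ->
  (forall k i, z k 0 i ^+ M.+1 = q i (z k)) -> (N <= M.+1 ^ m.+1)%N.
Proof.
move=> zinj qM zq.
pose E := {ffun 'I_m.+1 -> 'I_M.+1}.
(* The functions that coincide on the solutions with a combination of reduced
   monomials. *)
pose red (f : 'rV[R]_m.+1 -> R) := exists c : E -> R,
  forall k, f (z k) = \sum_(e : E) c e * mon (fun i => e i) (z k).
have red_poly D f : (forall e, (mdeg e <= D)%N -> red (mon e)) ->
    polyle D f -> red f.
  move=> redD; elim=> [|a e g eD _ [c cg]].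
    exists (fun=> 0) => k; by rewrite big1// => e _; rewrite mul0r.
  have [c' c'e] := redD _ eD.
  exists (fun e => a * c' e + c e) => k.
  rewrite cg c'e mulr_sumr -big_split/=; apply: eq_bigr => e' _.
  by rewrite mulrDl mulrA.
(* Induction on the degree: replacing x_i^(M+1) by q_i lowers it. *)
have red_mon D : forall e, (mdeg e <= D)%N -> red (mon e).
  elim/ltn_ind: D => D IH e eD.
  have [/forallP eM|] := boolP [forall i, (e i < M.+1)%N].
    exists (fun e' : E => (e' == [ffun i => Ordinal (eM i)])%:R) => k.
    rewrite (bigD1 [ffun i => Ordinal (eM i)])//= eqxx mul1r big1 ?addr0.
      by apply: eq_bigr => i _; rewrite ffunE.
    by move=> e' /negPf ->; rewrite mul0r.
  rewrite negb_forall => /existsP[i]; rewrite -leqNgt => Mei.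
  pose e' j := (e j - (j == i) * M.+1)%N.
  have ee' : mdeg e = (M.+1 + mdeg e')%N.
    rewrite /mdeg (bigD1 i)//= [in RHS](bigD1 i)//= addnA /e' eqxx mul1n subnKC//.
    by congr addn; apply: eq_bigr => j /negPf ->; rewrite subn0.
  have [] := @red_poly (M + mdeg e')%N (fun x => q i x * mon e' x).
  - by move=> e''; apply: IH; lia.
  - apply: polyleM => //; have := @polyle_mon R m _ 1 e' (leqnn _).
    by under eq_fun do rewrite mul1r.
  - move=> c cE; exists c => k; rewrite -cE -zq /mon (bigD1 i)//=.
    rewrite [X in _ = _ * X](bigD1 i)//= mulrA -exprD /e' eqxx mul1n subnKC//.
    by congr (_ * _); apply: eq_bigr => j /negPf ->; rewrite subn0.
(* All functions on the solution set are combinations of reduced monomials,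
   since its points can be separated by polynomials. *)
have sep k : exists f, red f /\ forall l, f (z l) = (l == k)%:R.
  have /choice[i iP] (l : 'I_N) : exists i, l != k -> z l 0 i != z k 0 i.
    have [//|lk] := eqVneq l k; first by exists ord0.
    apply: contrapT => /forallNP H.
    suff : z l = z k by move=> /zinj/eqP; rewrite (negPf lk).
    by apply/rowP => i; have /not_implyP[_ /negP/negPn/eqP] := H i.
  pose b (l : 'I_N) (x : 'rV[R]_m.+1) : R :=
    if l == k then 1 else (x 0 (i l) - z l 0 (i l)) / (z k 0 (i l) - z l 0 (i l)).
  exists (fun x => \prod_l b l x); split.
    apply: (@red_poly _ _ (@red_mon _)); apply: polyle_prod => l.
    rewrite /b; case: (l == k); first exact: (polyle_cst 1 1).
    under eq_fun do rewrite mulrC.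
    by apply/polyleZ/polyleD; [exact: polyle_coord|exact: polyle_cst].
  move=> l; have [->|lk] := eqVneq l k.
    rewrite big1// => l' _; rewrite /b; case: eqVneq => // /iP.
    by rewrite eq_sym -subr_eq0 => ?; rewrite divff.
  by rewrite (bigD1 l)//= /b (negPf lk) subrr mul0r mul0r.
have /choice[c cP] (k : 'I_N) : exists c : E -> R, forall l,
    \sum_(e : E) c e * mon (fun i => e i) (z l) = (l == k)%:R.
  by have [f [[c cf] fk]] := sep k; exists c => l; rewrite -cf fk.
(* The identity matrix of size N factors through the reduced monomials. *)
pose A := \matrix_(k < N, j < #|E|) c k (enum_val j).
pose B := \matrix_(j < #|E|, l < N) mon (fun i => (enum_val j : E) i) (z l).
have AB : A *m B = 1%:M.
  apply/matrixP => k l; rewrite !mxE eq_sym -cP.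
  rewrite [RHS](reindex (fun j : 'I_#|E| => enum_val j))/=.
    by apply: eq_bigr => j _; rewrite !mxE.
  by exists enum_rank => e _; [exact: enum_valK|exact: enum_rankK].
have := mxrankM_maxl A B; rewrite AB mxrank1 => /leq_trans -/(_ _ (rank_leq_col A)).
by rewrite card_ffun !card_ord.
Qed.
End DiagonalSystems.

(** * Sign patterns of polynomials *)

Section SignPatterns.
Context {R : realType}.

Lemma fin_pos_lbound (I : finType) (a : I -> R) :
  (forall i, 0 < a i) -> exists2 eps, 0 < eps & forall i, eps < a i.
Proof.
move=> a0; suff [eps e0 ea] : exists2 eps, 0 < eps & forall i, i \in enum I -> eps < a i.
  by exists eps => // i; apply: ea; rewrite mem_enum.
elim: (enum I) => [|i s [eps e0 IH]]; first by exists 1.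
exists (Num.min eps (a i / 2)); first by rewrite lt_min e0 divr_gt0.
move=> j; rewrite inE => /predU1P[->|/IH js]; rewrite gt_min ?js//.
by apply/orP; right; have := a0 i; lra.
Qed.

Context {m : nat}.
Implicit Types x : 'rV[R]_m.+1.

Lemma exists_max_coord x : exists i, forall j, `|x 0 j| <= `|x 0 i|.
Proof.
case: (@Order.TotalTheory.arg_maxP _ _ _ ord0 xpredT (fun i => `|x 0 i|)) => // i _ H.
by exists i => j; exact: H.
Qed.

Lemma continuous_line x (i : 'I_m.+1) :
  continuous (fun t : R => x + t *: (delta_mx 0 i : 'rV[R]_m.+1)).
Proof.
move=> t; exact: (continuousD (@cst_continuous _ _ x t) (@scalel_continuous _ _ _ t)).
Qed.

(** The realised vectors of signs are few. After adding a small constant eta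
    to each p_j, the witnesses avoid the zeros of G = prod_j (p_j + eta)^2.
    The function h = eps * sum_i x_i^(K+2) - G, with deg G <= K, is coercive,
    nonnegative on the zeros of G and negative at the witnesses, so it has a
    minimum inside each realised sign cell. There the gradient of h vanishes,
    which is a system x_i^(K+1) = q_i(x) with deg q_i <= K. *)
Lemma card_sign_patterns (J : finType) D (p : J -> 'rV[R]_m.+1 -> R) :
  (forall j, polyle D (p j)) ->
  (#|[set s : {ffun J -> bool} | `[< exists x, forall j, s j = (0 <= p j x)%R >]]%SET|
    <= (#|J| * (D + D)).+1 ^ m.+1)%N.
Proof.
move=> pD; set S := [set s | _]%SET; set K := (#|J| * (D + D))%N.
pose s (k : 'I_#|S|) : {ffun J -> bool} := enum_val k.
have /choice[w wP] (k : 'I_#|S|) : exists x, forall j, s k j = (0 <= p j x).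
  by have := enum_valP k; rewrite inE => /asboolP.
have [eta eta0 etaP] : exists2 eta, 0 < eta &
    forall kj : 'I_#|S| * J, p kj.2 (w kj.1) < 0 -> p kj.2 (w kj.1) + eta < 0.
  have [|eta eta0 H] := @fin_pos_lbound ('I_#|S| * J)%type
      (fun kj => if p kj.2 (w kj.1) < 0 then - p kj.2 (w kj.1) else 1).
    by move=> kj; case: ifPn => //; rewrite oppr_gt0.
  by exists eta => // kj p0; have := H kj; rewrite p0; lra.
(* The sign of f_j at the witnesses is never 0, and positive exactly where
   p_j >= 0. *)
pose f j x := p j x + eta.
have fD j : polyle D (f j) by apply: polyleD => //; exact: polyle_cst.
pose sg k j : R := if s k j then 1 else -1.
have sgf k j : 0 < sg k j * f j (w k).
  rewrite /sg wP /f; case: (leP 0 (p j (w k))) => [p0|/(etaP (k, j))/=]; lra.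
pose G x := \prod_(j <- enum J) (f j x * f j x).
have GK : polyle K G.
  by rewrite /K cardE; apply: polyle_prod => j; exact: polyleM.
have G0 x : 0 <= G x by apply: prodr_ge0 => j _; rewrite -expr2 sqr_ge0.
have Gf0 x j : f j x = 0 -> G x = 0.
  by move=> fj; rewrite /G big_enum (bigD1 j)//= fj !mul0r.
have Gw k : 0 < G (w k).
  rewrite lt_neqAle G0 andbT eq_sym /G big_enum; apply/prodf_neq0 => j _.
  suff fj : f j (w k) != 0 by rewrite mulf_neq0.
  by apply: contraTneq (sgf k j) => ->; rewrite mulr0 ltxx.
pose Q x : R := \sum_i x 0 i ^+ K.+2.
have Kev (t : R) : t ^+ K.+2 = `|t| ^+ K.+2.
  by rewrite -normrX ger0_norm// exprn_even_ge0//= /K addnn oddM odd_double andbF.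
have Q0 x : 0 <= Q x by apply: sumr_ge0 => i _; rewrite Kev exprn_ge0.
have [eps eps0 epsP] := @fin_pos_lbound _ (fun k => G (w k) / (1 + Q (w k)))
  (fun k => divr_gt0 (Gw k) (ltr_wpDr (Q0 _) ltr01)).
pose h x := - G x + eps * Q x.
have hw k : h (w k) < 0.
  have := epsP k; rewrite ltr_pdivlMr ?ltr_wpDr// mulrDr mulr1 /h => ?; lra.
have [Cg [Cg0 GC]] := polyle_growth GK.
pose r0 := 1 + Cg / eps.
have Ce0 : 0 <= Cg / eps by rewrite divr_ge0// ltW.
have hbig x : (exists i, r0 <= `|x 0 i|) -> 0 <= h x.
  move=> [i' i'r0]; have [i iP] := exists_max_coord x.
  have r1 : r0 <= `|x 0 i| by exact: le_trans (iP i').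
  have r1' : 1 <= `|x 0 i| by apply: le_trans r1; rewrite lerDl.
  have := GC _ _ r1' iP; rewrite ger0_norm// => Gx.
  have Qx : `|x 0 i| ^+ K.+2 <= Q x.
    rewrite /Q (bigD1 i)//= -Kev lerDl sumr_ge0// => j _.
    by rewrite Kev exprn_ge0.
  rewrite /h addrC subr_ge0 (le_trans Gx)//.
  apply: (@le_trans _ _ (eps * `|x 0 i| ^+ K.+2)); last by rewrite ler_pM2l.
  rewrite -[K.+2]addn2 exprD mulrCA mulrC ler_wpM2l ?exprn_ge0//.
  rewrite -ler_pdivrMl// mulrC expr2.
  have : Cg / eps <= `|x 0 i| by apply: le_trans r1; rewrite lerDr.
  by move: r1' Ce0; set a := Cg / eps; set b := `|_|; nra.
(* The closed sign cell of the k-th pattern, cut by the cube outside which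
   h >= 0. *)
pose A k := [set x : 'rV[R]_m.+1 | forall i, `[- r0, r0]%classic (x 0 i)] `&`
            \bigcap_(j in [set: J]) (fun x => sg k j * f j x) @^-1` [set t | 0 <= t].
have cf j : continuous (f j) by exact: polyle_continuous (fD j).
have csf k j : continuous (fun x => sg k j * f j x).
  exact: polyle_continuous (polyleZ _ (fD j)).
have cA k : compact (A k).
  apply: compact_closedI; last first.
    apply: closed_bigI => j _; apply: preimage_closed; last exact: closed_ge.
    by move=> x _; exact: csf.
  apply: (@rV_compact _ _ (fun=> `[- r0, r0]%classic)) => i.
  exact: segment_compact.
have ch : continuous h.
  apply: (@polyle_continuous _ _ K.+2); apply: polyleD.
    by apply/polyleN/(polyleW _ GK); lia.
  by apply/polyleZ/polyle_sum => i; exact: polyle_coordX.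
have norm_lt x : h x < 0 -> forall i, `|x 0 i| < r0.
  move=> hx i; rewrite ltNge; apply/negP => xi.
  have /hbig : exists i, r0 <= `|x 0 i| by exists i.
  by rewrite leNgt hx.
have wA k : A k (w k).
  split=> [i|j _]; last by rewrite /= ltW.
  by rewrite /= in_itv/= -ler_norml ltW// norm_lt.
have /choice[c cP] k : exists c, A k c /\ forall x, A k x -> h c <= h x.
  have [|c /set_mem cA' cm] := compact_EVT_min _ (cA k) (continuous_subspaceT ch).
    by exists (w k).
  by exists c; split => // x xA; apply: cm; exact: mem_set.
have hc k : h (c k) < 0 by apply: le_lt_trans (hw k); apply: (cP k).2.
(* h < 0 at the minimum c_k, so G does not vanish there and c_k is interior to
   its cell. *)
have sgc k j : 0 < sg k j * f j (c k).
  rewrite lt_neqAle (cP k).1.2 ?andbT//=; apply/eqP => /esym/eqP.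
  rewrite mulf_eq0 {1}/sg; case: (s k j); rewrite ?oppr_eq0 oner_eq0/= => /eqP/Gf0 Gc;
    by have := hc k; rewrite ltNge /h Gc oppr0 add0r mulr_ge0// ltW.
(* The i-th partial derivative of h vanishes at c_k. *)
have hG' i : exists2 q, polyle K q &
    forall k, c k 0 i ^+ K.+1 = q (c k).
  have [G' G'K dG] := polyle_derive i GK.
  exists (fun x => (eps * K.+2%:R)^-1 * G' x); first exact: polyleZ.
  move=> k; pose e : 'rV[R]_m.+1 := delta_mx 0 i.
  have near_A : \forall t \near (0 : R), A k (c k + t *: e).
    have n1 : \forall t \near (0 : R), forall i, `|(c k + t *: e) 0 i| < r0.
      apply: (@filter_forall R _ (fun j t => `|(c k + t *: e) 0 j| < r0) (nbhs (0 : R)) _) => j.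
      have cj : continuous (fun t : R => `|(c k + t *: e) 0 j|).
        move=> t; apply: (cvg_comp (fun t => (c k + t *: e) 0 j) Num.norm).
          apply: (cvg_comp (fun t => c k + t *: e) (fun x => x 0 j)).
            exact: continuous_line.
          exact: coord_continuous.
        exact: norm_continuous.
      have := cj 0 => /cvgr_lt; apply.
      by rewrite scale0r addr0 norm_lt.
    have n2 : \forall t \near (0 : R), forall j, 0 < sg k j * f j (c k + t *: e).
      apply: (@filter_forall R _ (fun j t => 0 < sg k j * f j (c k + t *: e))
        (nbhs (0 : R)) _) => j.
      have cj : continuous (fun t : R => sg k j * f j (c k + t *: e)).
        move=> t; apply: (cvg_comp (fun t => c k + t *: e) (fun x => sg k j * f j x)).
          exact: continuous_line.
        exact: csf.
      have := cj 0 => /cvgr_gt; apply.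
      by rewrite scale0r addr0.
    near=> t; split.
      move=> j; rewrite /= in_itv/= -ler_norml ltW//.
      by move: j; near: t.
    by move=> j _ /=; rewrite ltW//; move: j; near: t.
  have [d /= d0 dA] := near_A.
  pose g (t : R) := h (c k + t *: e).
  pose g' (t : R) := - G' (c k + t *: e) + eps * (K.+2%:R * (c k 0 i + t) ^+ K.+1).
  have dg (t : R) : is_derive t 1 g (g' t).
    have d1 : is_derive t 1 (+%R (c k 0 i)) 1.
      have := is_deriveD (is_derive_cst (c k 0 i) t 1) (is_derive_id t 1).
      by rewrite add0r.
    have dX := is_deriveZ eps (is_deriveX K.+2 d1).
    pose C := eps * \sum_(j | j != i) c k 0 j ^+ K.+2.
    have := is_deriveD (is_deriveD (is_deriveN (dG (c k) t)) dX) (is_derive_cst C t 1).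
    rewrite /GRing.scale/= mulr1 addr0.
    suff -> : g =
        - (fun s => G (c k + s *: e)) + eps \*: (+%R (c k 0 i)) ^+ K.+2 + cst C by [].
    apply/funext => s'; rewrite fctE /g /h /Q/= -addrA; congr (_ + _).
    rewrite [X in _ = X + _]/= /GRing.scale/= fctE -mulrDr; congr (_ * _).
    rewrite (bigD1 i)//= !mxE !eqxx mulr1; congr (_ + _).
    by apply: eq_bigr => j ji; rewrite !mxE (negPf ji) andbF mulr0 addr0.
  have gmin (t : R) : t \in `]- d, d[%R -> g 0 <= g t.
    rewrite in_itv/= -ltr_norml => td; rewrite /g scale0r addr0.
    by apply: (cP k).2; apply: dA; rewrite /ball_/= sub0r normrN.
  have dg0 : is_derive (0 : R) 1 g 0.
    apply: (@derive1_at_min _ g (- d) d 0) => //.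
    - by rewrite ge0_cp// ltW.
    - by rewrite in_itv/= oppr_lt0 d0.
  have := dg 0; rewrite /g' scale0r !addr0 => dg1.
  have : - G' (c k) + eps * (K.+2%:R * c k 0 i ^+ K.+1) = 0.
    by case: dg1 => _ <-; case: dg0.
  move/eqP; rewrite addrC subr_eq0 mulrA => /eqP <-.
  by rewrite mulKf// mulf_neq0// gt_eqF.
have /choice[q qP] (i : 'I_m.+1) : exists q, polyle K q /\
    forall k, c k 0 i ^+ K.+1 = q (c k).
  by have [q qK qc] := hG' i; exists q.
have cinj : injective c.
  move=> k l ckl; apply/enum_val_inj/ffunP => j.
  have := sgc k j; have := sgc l j; rewrite /sg ckl /s.
  by case: (enum_val k j); case: (enum_val l j) => // ? ?; lra.
exact: (card_diagonal_solutions cinj (fun i => (qP i).1) (fun k i => (qP i).2 k)).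
Unshelve. all: by end_near. Qed.

End SignPatterns.

(** * Networks as piecewise polynomials in their parameters *)

Section PiecewisePolynomials.
Context {R : realType} {m : nat}.

(** The values g_j(x), j in J, are at each point x those of one of at most k
    vectors of polynomial functions of degree at most D. The regions on which
    each vector is used are left unspecified. *)
Definition piecewise_poly (J : Type) (D k : nat) (g : J -> 'rV[R]_m.+1 -> R) : Prop :=
  exists (I : finType) (p : I -> J -> 'rV[R]_m.+1 -> R),
    [/\ (#|I| <= k)%N, forall i j, polyle D (p i j)
      & forall x, exists i, forall j, g j x = p i j x].

Lemma piecewise_polyW J D D' k k' (g : J -> 'rV[R]_m.+1 -> R) :
  (D <= D')%N -> (k <= k')%N ->
  piecewise_poly D k g -> piecewise_poly D' k' g.
Proof.
move=> DD' kk' [I [p [Ik pD gp]]]; exists I, p; split => //.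
  exact: leq_trans kk'.
by move=> i j; exact: polyleW (pD i j).
Qed.

Lemma piecewise_poly_map J J' D D' k (Phi : (J -> R) -> J' -> 'rV[R]_m.+1 -> R)
    (g : J -> 'rV[R]_m.+1 -> R) :
  (forall q : J -> 'rV[R]_m.+1 -> R, (forall j, polyle D (q j)) ->
    forall j', polyle D' (fun x => Phi (q ^~ x) j' x)) ->
  piecewise_poly D k g -> piecewise_poly D' k (fun j' x => Phi (g ^~ x) j' x).
Proof.
move=> PhiD [I [p [Ik pD gp]]].
exists I, (fun i j' x => Phi (p i ^~ x) j' x); split => //.
  by move=> i j'; exact: PhiD.
move=> x; have [i gi] := gp x; exists i => j'.
by congr (Phi _ _ _); apply/funext => j; exact: gi.
Qed.

(** Each piece splits according to the sign patterns of its polynomials. *)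
Lemma piecewise_poly_signs (J : finType) D k (g : J -> 'rV[R]_m.+1 -> R) :
  piecewise_poly D k g ->
  exists (I : finType) (p : I -> J -> 'rV[R]_m.+1 -> R) (s : I -> J -> bool),
    [/\ (#|I| <= k * (#|J| * (D + D)).+1 ^ m.+1)%N,
        forall i j, polyle D (p i j)
      & forall x, exists i, forall j, g j x = p i j x /\ (0 <= g j x) = s i j].
Proof.
move=> [I [p [Ik pD gp]]]; set N := (_.+1 ^ m.+1)%N.
pose S i := [set s : {ffun J -> bool} | `[< exists x, forall j, s j = (0 <= p i j x)%R >]]%SET.
exists (I * 'I_N)%type, (fun ib => p ib.1),
  (fun (ib : I * 'I_N) j => nth [ffun=> true] (enum (S ib.1)) ib.2 j); split.
- by rewrite card_prod card_ord leq_mul2r Ik orbT.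
- by move=> i j; exact: pD.
- move=> x; have [i gi] := gp x.
  pose s := [ffun j => 0 <= p i j x].
  have sS : s \in S i by rewrite inE; apply/asboolP; exists x => j; rewrite ffunE.
  have sN : (index s (enum (S i)) < N)%N.
    apply: leq_trans (card_sign_patterns (pD i)).
    by rewrite cardE index_mem mem_enum.
  exists (i, Ordinal sN) => j; split; first exact: gi.
  by rewrite /= nth_index ?mem_enum// ffunE gi.
Qed.

Lemma piecewise_poly_relu (J : finType) D k (g : J -> 'rV[R]_m.+1 -> R) :
  piecewise_poly D k g ->
  piecewise_poly D (k * (#|J| * (D + D)).+1 ^ m.+1) (fun j x => relu (g j x)).
Proof.
move=> /piecewise_poly_signs[I [p [s [Ik pD gp]]]].
exists I, (fun i j => if s i j then p i j else fun=> 0); split => //.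
  by move=> i j; case: (s i j) => //; exact: polyle0.
move=> x; have [i gi] := gp x; exists i => j; have [gij sij] := gi j.
by rewrite -sij /relu; case: leP => // _; exact: gij.
Qed.

End PiecewisePolynomials.

Section NetworkFamilies.
Context {R : realType} {m : nat}.
Implicit Types (t : 'rV[R]_m.+1) (ws : seq nat).

(** The network with hidden widths s.+1, s in ws, whose weights and shifts are
    read layer after layer in the parameter vector t from position o on. *)
Fixpoint eval_arch r ws (o : nat) t : 'cV[R]_r -> R :=
  match ws with
  | [::] => fun x => \sum_(j < r) t 0 (inord (o + j)) * x j 0
  | s :: ws' => fun x => @eval_arch s.+1 ws' (o + (s.+1 * r + s.+1)) t
      (\col_l relu (\sum_(j < r) t 0 (inord (o + (l * r + j))) * x j 0
                    - t 0 (inord (o + (s.+1 * r + l)))))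
  end.

(** The predecessors of the hidden widths, which are positive. *)
Fixpoint widths r (N : network (R:=R) r) : seq nat :=
  match N with
  | Affine_out _ _ => [::]
  | Hidden _ s _ _ N' => s :: widths N'
  end.

Lemma size_widths r (N : network (R:=R) r) : size (widths N) = nb_layers N.
Proof. by elim: N => //= r' s A V N' ->. Qed.

Lemma sumn_widths r (N : network (R:=R) r) :
  (r + sumn [seq s.+1 | s <- widths N] + 1)%N = nb_nodes N.
Proof.
by elim: N => [r' A|r' s A V N' IH] /=; [rewrite addn0|rewrite -IH; lia].
Qed.

Lemma nb_layers_le_params r (N : network (R:=R) r) : (nb_layers N <= nb_params N)%N.
Proof. by elim: N => //= r' s A V N'; lia. Qed.

(** Every network is a member of the parametric family of its widths; the
    parameters before position o can be prescribed. *)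
Lemma eval_net_arch r (N : network (R:=R) r) o t0 : (o + nb_params N <= m.+1)%N ->
  exists t, (forall k : 'I_m.+1, (k < o)%N -> t 0 k = t0 0 k) /\
    forall x, eval_net N x = eval_arch (widths N) o t x.
Proof.
elim: N o t0 => [r' A|r' s A V N' IH] o t0 /= om.
  exists (\row_k if (k < o)%N then t0 0 k
            else if insub (k - o)%N is Some j then A 0 j else 0).
  split=> [k ko|x]; first by rewrite mxE ko.
  rewrite mxE; apply: eq_bigr => j _; rewrite mxE inordK; last first.
    by have := ltn_ord j; lia.
  rewrite ltnNge leq_addr/= addKn; case: insubP => [j' _ jj'|]; last by rewrite ltn_ord.
  by congr (A _ _ * _); apply: val_inj.
pose t1 : 'rV[R]_m.+1 := \row_k if (k < o)%N then t0 0 k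
  else if (k - o < s.+1 * r')%N then
    (if insub ((k - o) %/ r')%N is Some l then
       if insub ((k - o) %% r')%N is Some j then A l j else 0 else 0)
  else if insub (k - o - s.+1 * r')%N is Some l then V l 0 else 0.
have [|t [tt1 tN]] := IH (o + (s.+1 * r' + s.+1))%N t1; first by lia.
exists t; split=> [k ko|x]; first by rewrite tt1 ?mxE ?ko//; lia.
rewrite tN; congr (eval_arch _ _ _ _); apply/colP => l; rewrite !mxE.
have lr (j : 'I_r') : (l * r' + j < s.+1 * r')%N.
  by have := ltn_ord j; have := ltn_ord l; nia.
have ls := ltn_ord l.
congr (relu (_ - _)).
  apply: eq_bigr => j _.
  have r0 : (0 < r')%N by apply: leq_ltn_trans (ltn_ord j).
  have lj := lr j; rewrite tt1 ?mxE inordK; try lia.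
  rewrite ltnNge leq_addr/= addKn lj divnMDl// divn_small// addn0 modnMDl modn_small//.
  case: insubP => [l' _ ll'|]; last by rewrite ls.
  case: insubP => [j' _ jj'|]; last by rewrite ltn_ord.
  by congr (A _ _ * _); exact: val_inj.
rewrite tt1 ?mxE inordK; try lia.
rewrite ltnNge leq_addr/= addKn ltnNge leq_addr/= addKn.
case: insubP => [l' _ ll'|]; last by rewrite ls.
by congr (V _ _); exact: val_inj.
Qed.

Lemma polyle_neuron r D (q : 'I_r -> 'rV[R]_m.+1 -> R) (a : 'I_r -> 'I_m.+1) :
  (forall j, polyle D (q j)) ->
  polyle D.+1 (fun t => \sum_(j < r) t 0 (a j) * q j t).
Proof.
move=> qD; apply: polyle_sum => j; rewrite -add1n.
by apply: polyleM => //; exact: polyle_coord.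
Qed.

(** Each layer raises the degree by one and multiplies the number of pieces by
    the number of sign patterns of its at most n * U preactivations. *)
Lemma piecewise_poly_eval_arch n U D0 ws r o D k
    (g : 'I_n -> 'I_r -> 'rV[R]_m.+1 -> R) :
  (forall s, s \in ws -> s < U)%N -> (D + size ws < D0)%N ->
  piecewise_poly D k (fun ij : 'I_n * 'I_r => g ij.1 ij.2) ->
  piecewise_poly D0 (k * ((n * U * (D0 + D0)).+1 ^ m.+1) ^ size ws)
    (fun i t => eval_arch ws o t (\col_j g i j t)).
Proof.
elim: ws r o D k g => [|s ws IH] r o D k g wsU DD0 gP.
  pose Phi (v : 'I_n * 'I_r -> R) (i : 'I_n) (t : 'rV[R]_m.+1) : R :=
    \sum_(j < r) t 0 (inord (o + j)) * v (i, j).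
  have -> : (fun i t => eval_arch [::] o t (\col_j g i j t)) =
      (fun i t => Phi (fun ij => g ij.1 ij.2 t) i t).
    apply/funext => i; apply/funext => t /=.
    by apply: eq_bigr => j _; rewrite mxE.
  apply: (@piecewise_polyW _ _ _ D.+1 _ k); [by rewrite /= addn0 in DD0|by rewrite expn0 muln1|].
  apply: piecewise_poly_map gP => q qD i.
  exact: (@polyle_neuron r D (fun j => q (i, j))).
set g' := fun (i : 'I_n) (l : 'I_s.+1) (t : 'rV[R]_m.+1) =>
  relu (\sum_(j < r) t 0 (inord (o + (l * r + j))) * g i j t
        - t 0 (inord (o + (s.+1 * r + l)))).
have -> : (fun i t => eval_arch (s :: ws) o t (\col_j g i j t)) =
    (fun i t => eval_arch ws (o + (s.+1 * r + s.+1)) t (\col_l g' i l t)).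
  apply/funext => i; apply/funext => t /=; congr (eval_arch _ _ _ _).
  apply/colP => l; rewrite !mxE; congr (relu (_ - _)).
  by apply: eq_bigr => j _; rewrite mxE.
rewrite /= expnS mulnA; apply: (IH _ _ D.+1) => //.
- by move=> s' s'ws; apply: wsU; rewrite inE s'ws orbT.
- by rewrite /= in DD0; lia.
have sU : (s < U)%N by apply: wsU; rewrite mem_head.
apply: (@piecewise_polyW _ _ _ D.+1 _
  (k * (#|{: 'I_n * 'I_s.+1}| * (D.+1 + D.+1)).+1 ^ m.+1)) => //.
  rewrite leq_mul2l leq_exp2r// ltnS card_prod !card_ord.
  apply/orP; right; apply: leq_mul; first by rewrite leq_mul2l sU orbT.
  by rewrite /= in DD0; lia.
pose Phi (v : 'I_n * 'I_r -> R) (il : 'I_n * 'I_s.+1) (t : 'rV[R]_m.+1) : R :=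
  \sum_(j < r) t 0 (inord (o + (il.2 * r + j))) * v (il.1, j)
        - t 0 (inord (o + (s.+1 * r + il.2))).
apply: (@piecewise_poly_relu _ _ ('I_n * 'I_s.+1)%type _ _
  (fun il t => Phi (fun ij => g ij.1 ij.2 t) il t)).
apply: piecewise_poly_map gP => q qD [i l].
apply: polyleD; first exact: (@polyle_neuron r D (fun j => q (i, j))).
by apply/polyleN/(polyleW _ (polyle_coord _)).
Qed.

End NetworkFamilies.

(** * Covering the networks on a finite set of points *)

Section NetworkCover.
Context {R : realType}.

(** The grid - F + k F / n for k from 0 to 2n, which divides [-F, F]. *)
Definition threshold (F : R) n (k : 'I_(2 * n).+1) : R := - F + k%:R * (F / n%:R).

(** The largest grid point selected by s; it is - F if s is empty. *)
Definition level (F : R) n (s : 'I_(2 * n).+1 -> bool) : R :=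
  - F + (\max_(k | s k) k)%:R * (F / n%:R).

Lemma level_bound (F : R) n (s : 'I_(2 * n).+1 -> bool) : 0 < F -> (0 < n)%N ->
  `|level F s| <= F.
Proof.
move=> F0 n0; have n0' : 0 < n%:R :> R by rewrite ltr0n.
have : (\max_(k | s k) k <= 2 * n)%N by apply/bigmax_leqP => k _; rewrite -ltnS.
rewrite /level; move: (\max_(k | s k) k) => K.
rewrite -(ler_nat R) natrM => Kn.
have FE : n%:R * (F / n%:R) = F by rewrite mulrC divfK// gt_eqF.
have d0 : 0 < F / n%:R by rewrite divr_gt0.
have K0 : 0 <= K%:R :> R by rewrite ler0n.
rewrite ler_norml; move: Kn FE d0 K0; set d := F / n%:R; set N : R := n%:R => Kn FE d0 K0.
by apply/andP; split; nra.
Qed.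

Lemma level_approx (F : R) n (u : R) : 0 < F -> (0 < n)%N -> `|u| <= F ->
  `|u - level F (fun k : 'I_(2 * n).+1 => 0 <= u - threshold F k)| <= F / n%:R.
Proof.
move=> F0 n0 uF; have n0' : 0 < n%:R :> R by rewrite ltr0n.
pose s (k : 'I_(2 * n).+1) := 0 <= u - threshold F k; rewrite /level -/s.
have d0 : 0 < F / n%:R by rewrite divr_gt0.
have FE : n%:R * (F / n%:R) = F by rewrite mulrC divfK// gt_eqF.
move: uF; rewrite ler_norml => /andP[u1 u2].
have s0 : s ord0 by rewrite /s /threshold mul0r addr0; lra.
have [|K sK maxK] := @eq_bigmax_cond _ s (fun k : 'I_(2 * n).+1 => k : nat).
  by apply/card_gt0P; exists ord0.
rewrite [in X in X%:R]maxK.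
have : 0 <= u - threshold F K by [].
rewrite /threshold => uK.
rewrite ler_norml; apply/andP; split; first lra.
have [Kn|Kn] := ltnP K (2 * n).
  have Kn' : (K.+1 < (2 * n).+1)%N by [].
  have : ~~ s (Ordinal Kn').
    apply/negP => sK'; have := @leq_bigmax_cond _ s (fun k : 'I_(2 * n).+1 => k : nat) _ sK'.
    by rewrite maxK /= ltnn.
  rewrite /s /threshold /= -ltNge -natr1 mulrDl mul1r; lra.
have -> : (K : nat) = (2 * n)%N by have := ltn_ord K; lia.
by rewrite natrM -mulrA FE; lra.
Qed.

Lemma supnorm_le_pointwise (X : Type) (f : X -> R) F x :
  (supnorm f <= F%:E)%E -> `|f x| <= F.
Proof.
move=> fF; rewrite -lee_fin; apply: le_trans fF.
by apply: ereal_sup_ubound; exists x.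
Qed.

Lemma card_cover_arith n U L W : (1 < n)%N -> (0 < L)%N -> (0 < W)%N -> (L < U)%N ->
  (U ^ L * (((n * U * (L.+1 + L.+1)).+1 ^ W) ^ L *
    (n * (2 * n).+1 * (L.+1 + L.+1)).+1 ^ W) <= (n * U) ^ (9 * W * L))%N.
Proof.
move=> n1 L0 W0 LU.
have -> : (9 * W * L = W * L + (4 * (W * L) + 4 * (W * L)))%N by rewrite -mulnA; lia.
have Y0 : (0 < n * U)%N by rewrite muln_gt0; lia.
have Y4 : ((n * U * (L.+1 + L.+1)).+1 <= (n * U) ^ 4 /\
          (n * (2 * n).+1 * (L.+1 + L.+1)).+1 <= (n * U) ^ 4)%N.
  have -> : ((n * U) ^ 4 = (n * n * (U * U)) * (n * n * (U * U)))%N.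
    by rewrite !expnS expn0 muln1; lia.
  have U2 : (1 < U)%N by lia.
  have LL : (L.+1 + L.+1 <= 2 * U)%N by lia.
  have nn : (2 * n <= n * n)%N by rewrite leq_mul2r; lia.
  have UU : (2 * U <= U * U)%N by rewrite leq_mul2r; lia.
  have nU : (4 <= n * U)%N by apply: (@leq_mul 2 2).
  have Z4 : (4 * (n * U) <= n * n * (U * U))%N by have := leq_mul nn UU; lia.
  split.
    have h1 : (n * U * (L.+1 + L.+1) <= n * n * (U * U))%N.
      apply: (@leq_trans (n * U * (2 * U))); first by rewrite leq_mul2l LL orbT.
      by have := leq_mul nn (leqnn (U * U)); lia.
    move: h1 Z4 nU; set z := (n * n * (U * U))%N; nia.
  have h1 : (n * (2 * n).+1 * (L.+1 + L.+1) <= n * (3 * n) * (2 * U))%N.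
    by apply: leq_mul => //; rewrite leq_mul2l; lia.
  have h2 : (n * (3 * n) * (2 * U) <= 3 * (n * n * (U * U)))%N.
    by have := leq_mul (leqnn (n * n)) UU; lia.
  by move: h1 h2 Z4 nU; set z := (n * n * (U * U))%N; nia.
rewrite expnD [((n * U) ^ (4 * _ + _))%N]expnD; apply: leq_mul.
  apply: (@leq_trans ((n * U) ^ L)%N); first by rewrite leq_exp2r// leq_pmull//; lia.
  by rewrite leq_pexp2l// leq_pmull.
apply: leq_mul.
  by rewrite -expnM [leqRHS]expnM leq_exp2r ?Y4.1// muln_gt0 W0 L0.
rewrite [leqRHS]expnM; apply: (@leq_trans (((n * U) ^ 4) ^ W)%N).
  by rewrite leq_exp2r ?Y4.2.
by rewrite leq_pexp2l ?expn_gt0 ?Y0// leq_pmulr.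
Qed.

Lemma relu_class_sizes d W U L (f : 'cV[R]_d -> R) :
  relu_class W U L f -> (0 < L)%N -> (0 < W)%N && (L < U)%N.
Proof.
move=> [N [<- <- <- _]] L0; rewrite (leq_trans L0 (nb_layers_le_params N))/=.
have sumn_ge (ws : seq nat) : (size ws <= sumn [seq s.+1 | s <- ws])%N.
  by elim: ws => //= s ws; lia.
by rewrite -sumn_widths -size_widths; have := sumn_ge (widths N); lia.
Qed.

(** The cover has U^L choices of widths, and for each of them the pieces given
    by the L hidden layers and by the n(2n+1) threshold tests. *)
Lemma network_cover d n W U L (F : R) (x : 'I_n -> 'cV[R]_d) (f0 : 'cV[R]_d -> R) :
  (1 < n)%N -> (0 < L)%N -> 0 < F -> relu_class W U L f0 ->
  exists v : 'I_((n * U) ^ (9 * W * L)) -> 'I_n -> R,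
    (forall k j, `|v k j| <= F) /\
    forall f, bounded_relu_class W U L F f ->
      exists k, forall j, `|f (x j) - v k j| <= F / n%:R.
Proof.
move=> n1 L0 F0 f0c; have /andP[W0 LU] := relu_class_sizes f0c L0.
have n0 : (0 < n)%N by lia.
case: W W0 {f0 f0c} => // m _.
set B1 := (((n * U * (L.+1 + L.+1)).+1 ^ m.+1) ^ L)%N.
set B2 := ((n * (2 * n).+1 * (L.+1 + L.+1)).+1 ^ m.+1)%N.
have cover (ws : L.-tuple 'I_U) : exists v : 'I_(B1 * B2) -> 'I_n -> R,
    (forall k j, `|v k j| <= F) /\
    forall t : 'rV[R]_m.+1, exists k, forall j,
      let u := eval_arch [seq nat_of_ord s | s <- ws] 0 t (x j) in
      `|u| <= F -> `|u - v k j| <= F / n%:R.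
  have /piecewise_poly_signs : piecewise_poly L.+1 B1
      (fun (jk : 'I_n * 'I_(2 * n).+1) (t : 'rV[R]_m.+1) =>
        eval_arch [seq nat_of_ord s | s <- ws] 0 t (x jk.1) - threshold F jk.2).
    pose Phi (u : 'I_n -> R) (jk : 'I_n * 'I_(2 * n).+1) (t : 'rV[R]_m.+1) : R :=
      u jk.1 - threshold F jk.2.
    have : piecewise_poly L.+1 B1 (fun i (t : 'rV[R]_m.+1) =>
        eval_arch [seq nat_of_ord s | s <- ws] 0 t (\col_j x i j 0)).
      have := @piecewise_poly_eval_arch R m n U L.+1 [seq nat_of_ord s | s <- ws] d 0 0 1
        (fun j i _ => x j i 0).
      rewrite size_map size_tuple mul1n -/B1; apply => //.
        by move=> _ /mapP[s _ ->].
      by exists unit, (fun _ ij _ => x ij.1 ij.2 0); split => [|_ ij|t];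
        [rewrite card_unit|exact: polyle_cst|exists tt].
    move/(@piecewise_poly_map _ _ _ _ _ _ _ Phi) => H.
    have -> : (fun (jk : 'I_n * 'I_(2 * n).+1) (t : 'rV[R]_m.+1) =>
        eval_arch [seq nat_of_ord s | s <- ws] 0 t (x jk.1) - threshold F jk.2) =
      (fun jk t => Phi (fun i => eval_arch [seq nat_of_ord s | s <- ws] 0 t
        (\col_j x i j 0)) jk t).
      apply/funext => jk; apply/funext => t; rewrite /Phi; congr (eval_arch _ _ _ _ - _).
      by apply/colP => j; rewrite mxE.
    apply: H => q qD jk; apply: polyleD; [exact: qD|exact: polyle_cst].
  rewrite card_prod !card_ord -/B2 => -[I [q [s [IB _ sP]]]].
  pose a (i : I) (j : 'I_n) : R := level F (fun k => s i (j, k)).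
  exists (fun b => nth (fun=> 0) [seq a i | i <- enum I] b); split=> [b j|t].
    have [bI|bI] := ltnP b (size [seq a i | i <- enum I]); last first.
      by rewrite nth_default// normr0 ltW.
    have := mem_nth (fun=> 0) bI; case/mapP => i _ ->; exact: level_bound.
  have [i iP] := sP t.
  have iB : (enum_rank i < B1 * B2)%N by apply: leq_trans IB.
  exists (Ordinal iB) => j u uF.
  rewrite (nth_map i) ?size_enum_ord -?cardE//= nth_enum_rank.
  rewrite /a (_ : (fun k => s i (j, k)) = (fun k => 0 <= u - threshold F k)).
    exact: level_approx.
  by apply/funext => k; rewrite -(iP (j, k)).2.
have /choice[v vP] := cover.
have NbE : #|{: L.-tuple 'I_U * 'I_(B1 * B2)}| = (U ^ L * (B1 * B2))%N.
  by rewrite card_prod card_tuple !card_ord.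
have NbN : (#|{: L.-tuple 'I_U * 'I_(B1 * B2)}| <= (n * U) ^ (9 * m.+1 * L))%N.
  by rewrite NbE card_cover_arith.
(* The index set is larger than the set of pairs (widths, piece): the unused
   indices get the zero vector. *)
exists (fun b j => if insub (b : nat) is Some c then
    let wk := enum_val (c : 'I_#|{: L.-tuple 'I_U * 'I_(B1 * B2)}|) in v wk.1 wk.2 j
  else 0); split=> [b j|f [[N [NW NU NL ->]] NF]].
  case: insubP => [c _ _|_]; last by rewrite normr0 ltW.
  exact: (vP _).1.
have wsU s : s \in widths N -> (s < U)%N.
  move=> sN; rewrite -NU -sumn_widths.
  have : (s.+1 <= sumn [seq s.+1 | s <- widths N])%N.
    by rewrite sumnE big_map (big_rem s)//= leq_addr.
  lia.
pose ws := [seq (insubd (Ordinal (leq_ltn_trans (leq0n _) LU)) s : 'I_U) | s <- widths N].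
have wsE : [seq nat_of_ord s | s <- ws] = widths N.
  rewrite -map_comp -[RHS]map_id; apply/eq_in_map => s /wsU sU /=.
  by rewrite val_insubd sU.
have szws : size ws == L by rewrite size_map size_widths NL.
have [|t [_ tN]] := @eval_net_arch R m d N 0 0; first by rewrite NW.
have [k kP] := (vP (Tuple szws)).2 t.
pose wk := (Tuple szws, k).
have wkN : (enum_rank wk < (n * U) ^ (9 * m.+1 * L))%N by apply: leq_trans NbN.
exists (Ordinal wkN) => j /=.
rewrite insubT//= => ltk.
rewrite (_ : Sub (enum_rank wk : nat) ltk = enum_rank wk); last exact: val_inj.
have := kP j; rewrite enum_rankK /= wsE -tN; apply.
exact: supnorm_le_pointwise NF.
Qed.

(** A linear function is bounded only if it vanishes. *)
Lemma bounded_relu_class0 d W U (F : R) (f : 'cV[R]_d -> R) x :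
  bounded_relu_class W U 0 F f -> f x = 0.
Proof.
move=> [[N [_ _ NL ->]] NF]; case: N x NL NF => //= r A x _ AF.
apply/eqP/contraT => Ax0.
have := supnorm_le_pointwise (((F + 1) / (A *m x) 0 0) *: x) AF.
have := supnorm_le_pointwise 0 AF; rewrite /= mulmx0 mxE normr0 => F0.
rewrite /= -scalemxAr mxE divfK// ger0_norm; lra.
Qed.
End NetworkCover.

(** * Products of functions of independent variables *)

Section IndependentProducts.
Import HBNNSimple.
Context {disp : measure_display} {T : measurableType disp} {R : realType}.
Context (P : probability T R).

Lemma nnsfun_indic_sum (g : {nnsfun R >-> R}) :
  exists k (a : 'I_k -> R) (A : 'I_k -> set R),
    [/\ forall i, 0 <= a i, forall i, measurable (A i)
      & forall y, g y = \sum_i a i * \1_(A i) y].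
Proof.
pose s := finmap.enum_fset (fset_set (range g)).
exists (size s), (fun i => s`_i), (fun i => g @^-1` [set s`_i]); split.
- move=> i; have := mem_nth 0 (ltn_ord i).
  by rewrite in_fset_set// => /set_mem[y _ <-].
- by move=> i; exact: measurable_sfunP.
- by move=> y; exact: fimfunEord.
Qed.

Lemma measurable_RV_comp (X : {RV P >-> R}) (h : R -> R) :
  measurable_fun [set: R] h -> measurable_fun [set: T] (fun w => h (X w)).
Proof. by move=> mh; exact: measurableT_comp. Qed.

(** A product formula known for indicators of X extends to finite nonnegative
    combinations of indicators, then, by monotone convergence, to nonnegative
    measurable functions of X. *)
Lemma integral_mul_indic_sum (X : {RV P >-> R}) (G : T -> R) (C : R)
    k (a : 'I_k -> R) (A : 'I_k -> set R) (g : R -> R) :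
  measurable_fun [set: T] G -> (forall w, 0 <= G w) -> 0 <= C ->
  (forall A : set R, measurable A ->
    (\int[P]_w (G w * \1_A (X w))%:E = C%:E * P (X @^-1` A))%E) ->
  (forall i, 0 <= a i) -> (forall i, measurable (A i)) ->
  (forall y, g y = \sum_i a i * \1_(A i) y) ->
  (\int[P]_w (G w * g (X w))%:E =
   C%:E * \sum_i (a i)%:E * P (X @^-1` A i))%E.
Proof.
move=> mG G0 C0 GX a0 mA gE.
transitivity (\sum_i \int[P]_w ((a i)%:E * (G w * \1_(A i) (X w))%:E))%E.
  rewrite -ge0_integral_sum//=.
  - apply: eq_integral => w _; rewrite gE mulr_sumr -sumEFin.
    by apply: eq_bigr => i _; rewrite -EFinM mulrCA.
  - move=> i; apply: measurable_funeM; apply/measurable_EFinP.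
    apply: measurable_funM => //; apply: (@measurable_RV_comp X \1_(A i)).
    exact: measurable_indic.
  - by move=> i w _; rewrite -EFinM lee_fin mulr_ge0// mulr_ge0// indicE ler0n.
rewrite ge0_sume_distrr; last by move=> i _; rewrite mule_ge0 ?lee_fin.
apply: eq_bigr => i _; rewrite ge0_integralZl//.
- by rewrite GX// muleCA.
- apply/measurable_EFinP; apply: measurable_funM => //.
  by apply: (@measurable_RV_comp X \1_(A i)); exact: measurable_indic.
- by move=> w _; rewrite lee_fin mulr_ge0// indicE ler0n.
- by rewrite lee_fin.
Qed.

Lemma ge0_integral_mul_indep (X : {RV P >-> R}) (G : T -> R) (C : R) (h : R -> R) :
  measurable_fun [set: T] G -> (forall w, 0 <= G w) -> 0 <= C ->
  (forall A : set R, measurable A ->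
    (\int[P]_w (G w * \1_A (X w))%:E = C%:E * P (X @^-1` A))%E) ->
  measurable_fun [set: R] h -> (forall y, 0 <= h y) ->
  (\int[P]_w (G w * h (X w))%:E = C%:E * \int[P]_w (h (X w))%:E)%E.
Proof.
move=> mG G0 C0 GX mh h0.
have mh' : measurable_fun [set: R] (EFin \o h) by exact/measurable_EFinP.
pose g := nnsfun_approx measurableT mh'.
have gh y : EFin \o g ^~ y @ \oo --> (h y)%:E.
  by apply: cvg_nnsfun_approx => // z _; rewrite lee_fin.
have g0 k y : 0 <= g k y by [].
have gnd y : {homo (fun k => g k y) : k l / (k <= l)%N >-> k <= l}.
  by move=> k l kl; have /lefP := nd_nnsfun_approx measurableT mh' kl; exact.
have mg k : measurable_fun [set: T] (fun w => g k (X w)) by exact: measurable_RV_comp.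
have lim (H : T -> R) : measurable_fun [set: T] H -> (forall w, 0 <= H w) ->
    (\int[P]_w (H w * g k (X w))%:E @[k --> \oo] --> \int[P]_w (H w * h (X w))%:E)%E.
  move=> mH H0.
  have -> : (\int[P]_w (H w * h (X w))%:E =
             \int[P]_w (limn (fun k => (H w * g k (X w))%:E)))%E.
    apply: eq_integral => w _; apply/esym/cvg_lim => //.
    under eq_fun do rewrite EFinM; rewrite EFinM.
    by apply: cvgeZl => //; exact: gh.
  apply: cvg_monotone_convergence => //.
  - by move=> k; apply/measurable_EFinP; exact: measurable_funM.
  - by move=> k w _; rewrite lee_fin mulr_ge0.
  - by move=> w _ k l kl; rewrite lee_fin ler_wpM2l// gnd.
have step k : (\int[P]_w (G w * g k (X w))%:E = C%:E * \int[P]_w (1 * g k (X w))%:E)%E.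
  have [r [a [A [a0 mA gE]]]] := nnsfun_indic_sum (g k).
  rewrite (integral_mul_indic_sum mG G0 C0 GX a0 mA gE).
  rewrite (@integral_mul_indic_sum X (fun=> 1) 1 r a A (g k))//.
  - by rewrite mul1e.
  - move=> B mB; under eq_integral do rewrite mul1r.
    rewrite mul1e (_ : (fun w => _) = (fun w => (\1_(X @^-1` B) w)%:E)) //.
    rewrite integral_indic ?setIT//.
    by rewrite -[X @^-1` B]setTI; exact: measurable_funPT.
have l1 := lim _ mG G0; have l2 := lim (fun=> 1) (@measurable_cst _ _ _ _ _ _) (fun=> ler01).
have l3 := cvgeZl (y := C%:E) isT l2.
have {}l1 : (C%:E * \int[P]_w (1 * g k (X w))%:E @[k --> \oo] --> \int[P]_w (G w * h (X w))%:E)%E.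
  by under eq_fun do rewrite -step.
rewrite (cvg_unique _ l1 l3)//; congr (_ * _)%E.
by apply: eq_integral => w _; rewrite mul1r.
Qed.

Lemma measurable_preim_RV (X : {RV P >-> R}) (A : set R) :
  measurable A -> measurable (X @^-1` A).
Proof. by move=> mA; rewrite -[_ @^-1` _]setTI; exact: measurable_funPT. Qed.

Lemma integral_indic_RV (X : {RV P >-> R}) (A : set R) : measurable A ->
  (\int[P]_w (\1_A (X w))%:E = P (X @^-1` A))%E.
Proof.
move=> mA; rewrite -[in RHS](setIT (X @^-1` A)) -integral_indic//.
exact: measurable_preim_RV.
Qed.

Lemma integral_bounded_fin_num (f : T -> R) b : measurable_fun [set: T] f ->
  (forall w, 0 <= f w <= b) -> (\int[P]_w (f w)%:E \is a fin_num)%E.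
Proof.
move=> mf fb; have f0 w : 0 <= f w by case/andP: (fb w).
rewrite ge0_fin_numE; last by apply: integral_ge0 => w _; rewrite lee_fin.
apply: (@le_lt_trans _ _ (\int[P]_w (cst b%:E) w)%E).
  apply: ge0_le_integral => //=.
  - by move=> w _; rewrite lee_fin.
  - exact/measurable_EFinP.
  - by move=> w _; rewrite lee_fin; case/andP: (fb w).
by rewrite integral_cst//= probability_setT mule1 ltry.
Qed.

(** Independence of events implies that the expectation of a product of
    functions of the variables is the product of the expectations. *)
Lemma indep_integral_prod n (y : 'I_n -> {RV P >-> R}) (u : 'I_n -> R -> R) b :
  mutually_independent y -> (forall i, measurable_fun [set: R] (u i)) ->
  (forall i t, 0 <= u i t <= b) ->
  (\int[P]_w (\prod_i u i (y i w))%:E = \prod_i \int[P]_w (u i (y i w))%:E)%E.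
Proof.
move=> yind mu ub.
(* The factors are replaced one at a time: at stage k, those of index at least
   k are indicators. *)
suff H k : forall u : 'I_n -> R -> R, (forall i, measurable_fun [set: R] (u i)) ->
    (forall i t, 0 <= u i t <= Num.max 1 b) ->
    (forall i : 'I_n, (k <= i)%N -> exists2 A, measurable A & u i = \1_A) ->
    (\int[P]_w (\prod_i u i (y i w))%:E = \prod_i \int[P]_w (u i (y i w))%:E)%E.
  apply: (H n) => //; last by move=> i; rewrite leqNgt ltn_ord.
  by move=> i t; have /andP[u0 u1] := ub i t; rewrite u0 le_max u1 orbT.
elim: k => [|k IH] {mu ub}u mu ub uA.
  have /choice[A AP] (i : 'I_n) : exists A, measurable A /\ u i = \1_A.
    by have [A mA uiA] := uA i (leq0n _); exists A.
  have uP i : (\int[P]_w (u i (y i w))%:E = P (y i @^-1` A i))%E.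
    by rewrite (AP i).2 integral_indic_RV//; exact: (AP i).1.
  rewrite [RHS](eq_bigr _ (fun i _ => uP i)).
  have := yind [set: 'I_n]%SET A (fun i => (AP i).1).
  rewrite [in X in _ = X -> _](eq_bigl xpredT) => [|i]; last by rewrite inE.
  move=> <-; set B := \bigcap_(i in _) _.
  have mB : measurable B.
    by apply: fin_bigcap_measurable => // i _; apply: measurable_preim_RV; exact: (AP i).1.
  rewrite -[in RHS](setIT B) -integral_indic//; apply: eq_integral => w _; congr _%:E.
  rewrite indicE; have [wB|wB] := boolP (w \in B).
    rewrite big1// => i _; rewrite (AP i).2 indicE mem_set//.
    by move/set_mem: wB; apply; rewrite /= inE.
  apply/eqP/prodf_eq0; move/negP: wB => wB.
  have [i Ai] : exists i, ~ A i (y i w).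
    by apply/existsNP => H; apply: wB; apply: mem_set => i _; exact: H.
  by exists i => //; rewrite (AP i).2 indicE memNset.
have [nk|kn] := leqP n k.
  by apply: IH => // i ki; apply: uA; have := ltn_ord i; lia.
pose i0 := Ordinal kn.
have mui (v : R -> R) i : measurable_fun [set: R] v ->
  measurable_fun [set: T] (fun w => v (y i w)) by exact: measurable_RV_comp.
have fin i : (\int[P]_w (u i (y i w))%:E \is a fin_num)%E.
  by apply: (@integral_bounded_fin_num _ (Num.max 1 b)); [exact: mui|move=> w; exact: ub].
have u0 i t : 0 <= u i t by case/andP: (ub i t).
pose G w := \prod_(i | i != i0) u i (y i w).
pose C := \prod_(i | i != i0) fine (\int[P]_w (u i (y i w))%:E)%E.
have CE : (C%:E = \prod_(i | i != i0) \int[P]_w (u i (y i w))%:E)%E.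
  by rewrite /C -prodEFin; apply: eq_bigr => i _; rewrite fineK.
rewrite [RHS](bigD1 i0)//= -CE muleC.
under eq_integral do rewrite (bigD1 i0)//= mulrC.
apply: ge0_integral_mul_indep => //.
- rewrite /G; under eq_fun do rewrite -big_filter.
  by apply: measurable_prod => i _; exact: mui.
- by move=> w; apply: prodr_ge0.
- by apply: prodr_ge0 => i _; apply/fine_ge0/integral_ge0 => w _; rewrite lee_fin.
- move=> A mA.
  pose v i := if i == i0 then \1_A else u i.
  have v0 : v i0 = \1_A by rewrite /v eqxx.
  have vN i : i != i0 -> v i = u i by rewrite /v => /negPf ->.
  have IHv : (\int[P]_w (\prod_i v i (y i w))%:E = \prod_i \int[P]_w (v i (y i w))%:E)%E.
    apply: IH => [i|i t|i ki].
    - have [->|/vN ->//] := eqVneq i i0; rewrite v0; exact: measurable_indic.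
    - have [->|/vN ->//] := eqVneq i i0; rewrite v0 indicE ler0n/= le_max.
      by case: (_ \in _); rewrite ?lexx// ler01.
    - have [->|ii0] := eqVneq i i0; first by exists A.
      rewrite vN//; apply: uA; rewrite ltn_neqAle ki andbT.
      by apply: contra ii0 => /eqP ki'; apply/eqP/val_inj.
  rewrite (bigD1 i0)//= v0 integral_indic_RV// muleC in IHv.
  rewrite (eq_bigr _ (fun i ii0 => congr1 (fun f => \int[P]_w (f (y i w))%:E)%E (vN i ii0))) in IHv.
  rewrite CE -IHv; apply: eq_integral => w _.
  rewrite [X in _ = X%:E](bigD1 i0)//= v0 mulrC.
  by congr (_ * _)%:E; apply: eq_bigr => i /vN ->.
Qed.
End IndependentProducts.

(** * Means and the quantile loss *)

Section BoundedMeans.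
Context {disp : measure_display} {T : measurableType disp} {R : realType}.
Context (P : probability T R).
Implicit Types f g : T -> R.

(** Bounded measurable functions, which are integrable. *)
Definition bounded_mf f : Prop :=
  measurable_fun [set: T] f /\ exists b, forall w, `|f w| <= b.

(** The real-valued expectation; it is used on bounded measurable functions. *)
Definition mean f : R := (\int[P]_w f w)%R.

Lemma bounded_mf_integrable f : bounded_mf f -> P.-integrable [set: T] (EFin \o f).
Proof.
move=> [mf [b fb]]; apply: measurable_bounded_integrable => //=.
  by rewrite probability_setT ltry.
exists b; split; first exact: num_real.
by move=> c bc w _ /=; rewrite (le_trans (fb w))// ltW.
Qed.
Hint Resolve bounded_mf_integrable : core.

Lemma bounded_mf_cst a : bounded_mf (fun=> a).
Proof. by split=> //; exists `|a|. Qed.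

Lemma bounded_mfD f g : bounded_mf f -> bounded_mf g -> bounded_mf (fun w => f w + g w).
Proof.
move=> [mf [b fb]] [mg [c gc]]; split; first exact: measurable_funD.
by exists (b + c) => w; rewrite (le_trans (ler_normD _ _))// lerD.
Qed.

Lemma bounded_mfM f g : bounded_mf f -> bounded_mf g -> bounded_mf (fun w => f w * g w).
Proof.
move=> [mf [b fb]] [mg [c gc]]; split; first exact: measurable_funM.
by exists (b * c) => w; rewrite normrM ler_pM.
Qed.

Lemma bounded_mfZ a f : bounded_mf f -> bounded_mf (fun w => a * f w).
Proof. by move=> bf; apply: bounded_mfM => //; exact: bounded_mf_cst. Qed.

Lemma bounded_mfB f g : bounded_mf f -> bounded_mf g -> bounded_mf (fun w => f w - g w).
Proof.
move=> bf bg; apply: bounded_mfD => //.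
by have := bounded_mfZ (-1) bg; under eq_fun do rewrite mulN1r.
Qed.

Lemma bounded_mf_sum (I : Type) (s : seq I) (f : I -> T -> R) :
  (forall i, bounded_mf (f i)) -> bounded_mf (fun w => \sum_(i <- s) f i w).
Proof.
move=> bf; elim: s => [|i s IH].
  by under eq_fun do rewrite big_nil; exact: bounded_mf_cst.
by under eq_fun do rewrite big_cons; exact: bounded_mfD.
Qed.

Lemma bounded_mf_expR f : bounded_mf f -> bounded_mf (fun w => expR (f w)).
Proof.
move=> [mf [b fb]]; split; first by apply: (measurableT_comp (@measurable_expR R)).
exists (expR b) => w; rewrite ger0_norm ?expR_ge0// ler_expR.
exact: le_trans (ler_norm _) (fb w).
Qed.

Lemma bounded_mf_indic (X : {RV P >-> R}) (A : set R) : measurable A ->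
  bounded_mf (fun w => \1_A (X w)).
Proof.
move=> mA; split; last by exists 1 => w; rewrite indicE; case: (_ \in _); rewrite ?normr1 ?normr0.
by apply: (@measurable_RV_comp _ _ _ _ X (\1_A)); exact: measurable_indic.
Qed.

Lemma meanE f : bounded_mf f -> ((mean f)%:E = \int[P]_w (f w)%:E)%E.
Proof.
move=> bf; rewrite /mean /Rintegral fineK// integrable_fin_num//.
exact: bounded_mf_integrable.
Qed.

Lemma expectation_mean f : bounded_mf f -> 'E_P[f]%E = (mean f)%:E.
Proof. by move=> bf; rewrite unlock meanE. Qed.

Lemma mean_cst a : mean (fun=> a) = a.
Proof. by rewrite /mean Rintegral_cst//= probability_setT mulr1. Qed.

Lemma meanD f g : bounded_mf f -> bounded_mf g ->
  mean (fun w => f w + g w) = mean f + mean g.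
Proof. by move=> bf bg; rewrite /mean RintegralD//; exact: bounded_mf_integrable. Qed.

Lemma meanB f g : bounded_mf f -> bounded_mf g ->
  mean (fun w => f w - g w) = mean f - mean g.
Proof. by move=> bf bg; rewrite /mean RintegralB//; exact: bounded_mf_integrable. Qed.

Lemma meanZ a f : bounded_mf f -> mean (fun w => a * f w) = a * mean f.
Proof. by move=> bf; rewrite /mean RintegralZl//; exact: bounded_mf_integrable. Qed.

Lemma mean_sum (I : Type) (s : seq I) (f : I -> T -> R) :
  (forall i, bounded_mf (f i)) ->
  mean (fun w => \sum_(i <- s) f i w) = \sum_(i <- s) mean (f i).
Proof.
move=> bf; elim: s => [|i s IH].
  by under eq_fun do rewrite big_nil; rewrite mean_cst big_nil.
under eq_fun do rewrite big_cons; rewrite big_cons meanD ?IH//.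
exact: bounded_mf_sum.
Qed.

Lemma le_mean f g : bounded_mf f -> bounded_mf g -> (forall w, f w <= g w) ->
  mean f <= mean g.
Proof.
by move=> bf bg fg; apply: le_Rintegral => //; exact: bounded_mf_integrable.
Qed.

Lemma mean_le_bound f a : bounded_mf f -> (forall w, `|f w| <= a) -> `|mean f| <= a.
Proof.
move=> bf fa; rewrite ler_norml -{1}(mean_cst (- a)) -[X in _ && (_ <= X)](mean_cst a).
by apply/andP; split; apply: le_mean => //;
  first [exact: bounded_mf_cst | by move=> w; have := fa w; rewrite ler_norml => /andP[]].
Qed.

Lemma mean_indic (X : {RV P >-> R}) (A : set R) : measurable A ->
  (mean (fun w => \1_A (X w)))%:E = P (X @^-1` A).
Proof. by move=> mA; rewrite meanE ?integral_indic_RV//; exact: bounded_mf_indic. Qed.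

End BoundedMeans.

Section QuantileLoss.
Context {R : realType}.
Implicit Types tau q v t s : R.

(** The excess of the quantile loss at t of the prediction v over that of q. *)
Definition loss_diff tau q v t : R := quantile_loss tau (t - v) - quantile_loss tau (t - q).

Lemma quantile_loss_pos tau t : 0 <= t -> quantile_loss tau t = tau * t.
Proof. by move=> t0; rewrite /quantile_loss; apply: max_l; nra. Qed.

Lemma quantile_loss_neg tau t : t <= 0 -> quantile_loss tau t = (tau - 1) * t.
Proof. by move=> t0; rewrite /quantile_loss; apply: max_r; nra. Qed.

Lemma measurable_quantile_loss tau : measurable_fun [set: R] (quantile_loss tau).
Proof. by apply: measurable_maxr; apply: measurable_funM. Qed.

Lemma quantile_loss_lipschitz tau s t : 0 < tau < 1 ->
  `|quantile_loss tau s - quantile_loss tau t| <= `|s - t|.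
Proof.
move=> /andP[t0 t1].
have [s0|s0] := leP 0 s; have [u0|u0] := leP 0 t;
  rewrite ?(quantile_loss_pos _ s0) ?(quantile_loss_pos _ u0)
    ?(quantile_loss_neg _ (ltW s0)) ?(quantile_loss_neg _ (ltW u0));
  rewrite ler_norml; have := ler_norm (s - t); have := ler_norm (t - s);
  rewrite (distrC t s) => ? ?; apply/andP; split; nra.
Qed.

Lemma loss_diff_bound tau q v t : 0 < tau < 1 -> `|loss_diff tau q v t| <= `|v - q|.
Proof.
move=> tau01; apply: (le_trans (quantile_loss_lipschitz _ _ tau01)).
by rewrite (_ : t - v - (t - q) = - (v - q)) ?normrN//; ring.
Qed.

Lemma measurable_loss_diff tau q v : measurable_fun [set: R] (loss_diff tau q v).
Proof.
apply: measurable_funB; apply: (measurableT_comp (measurable_quantile_loss tau));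
  exact: measurable_funB.
Qed.

(** A lower bound whose expectation only involves the masses of two intervals:
    beyond the linear term, the loss gains at least (v - q) / 2 on ]q, q + s]. *)
Lemma loss_diff_ge_right tau q v s t : 0 < tau < 1 -> q <= v -> 0 <= s -> s <= (v - q) / 2 ->
  (v - q) * (\1_(`]-oo, q]) t - tau) + (v - q) / 2 * \1_(`]q, q + s]) t
    <= loss_diff tau q v t.
Proof.
move=> /andP[t0 t1] qv s0 sq; rewrite !indicE /loss_diff.
rewrite !mem_setE !in_itv/=.
have [tq|tq] := leP t q; rewrite ?mulr1 ?mulr0 /=.
  rewrite !quantile_loss_neg; [nra|lra|lra].
rewrite [quantile_loss tau (t - q)]quantile_loss_pos; last lra.
have [tqs|tqs] /= := leP t (q + s).
  rewrite quantile_loss_neg; [nra|lra].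
have [tv|tv] := leP t v.
  rewrite quantile_loss_neg; [nra|lra].
by rewrite quantile_loss_pos; [nra|lra].
Qed.

(** The mirror image, with open and closed ends exchanged. *)
Lemma loss_diff_ge_left tau q v s t : 0 < tau < 1 -> v <= q -> 0 <= s -> s <= (q - v) / 2 ->
  (q - v) * (tau - \1_(`]-oo, q[) t) + (q - v) / 2 * \1_(`[q - s, q[) t
    <= loss_diff tau q v t.
Proof.
move=> /andP[t0 t1] qv s0 sq; rewrite !indicE /loss_diff.
rewrite !mem_setE !in_itv/=.
have [tq|tq] := leP q t; rewrite ?andbF ?mulr1 ?mulr0 /=.
  rewrite !quantile_loss_pos; [nra|lra|lra].
rewrite andbT [quantile_loss tau (t - q)]quantile_loss_neg; last lra.
have [tqs|tqs] /= := leP (q - s) t.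
  rewrite quantile_loss_pos; [nra|lra].
have [tv|tv] := leP t v.
  rewrite quantile_loss_neg; [nra|lra].
by rewrite quantile_loss_pos; [nra|lra].
Qed.

End QuantileLoss.

(** * The margin of the expected quantile loss *)

Section QuantileMargin.
Context {disp : measure_display} {T : measurableType disp} {R : realType}.
Context (P : probability T R).
Context (X : {RV P >-> R}) (p : R -> R) (Xp : is_density X p).

Lemma density_ge r (A : set R) : measurable A -> 0 <= r ->
  (forall t, A t -> r <= p t) ->
  (r%:E * lebesgue_measure A <= P (X @^-1` A))%E.
Proof.
move=> mA r0 rp; have [mp p0 pE] := Xp.
rewrite -[P _]/(distribution P X A) pE// -integral_cst//.
apply: ge0_le_integral => //=.
by apply/measurable_EFinP; exact: measurable_funTS.
Qed.

Lemma density_le r (A : set R) : measurable A -> (forall t, p t <= r) ->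
  (P (X @^-1` A) <= r%:E * lebesgue_measure A)%E.
Proof.
move=> mA pr; have [mp p0 pE] := Xp.
rewrite -[P _]/(distribution P X A) pE// -integral_cst//.
apply: ge0_le_integral => //=.
- by move=> t At; rewrite lee_fin.
- by apply/measurable_EFinP; exact: measurable_funTS.
- by move=> t At; rewrite lee_fin.
Qed.

Context (tau c : R) (tau01 : 0 < tau < 1) (c0 : 0 < c) (pc : forall t, p t <= c).
Let q := quantile X tau.

(** The set whose infimum is the quantile q. *)
Definition cdf_level_set := [set t : R | (tau%:E <= cdf X t)%E].

Lemma cdf_level_set_has_inf : has_inf cdf_level_set.
Proof.
have /andP[t0 t1] := tau01.
split.
  have : \forall r \near +oo, (tau%:E < cdf X r)%E.
    have /(@open_ereal_gt' R) : (tau%:E < 1 :> \bar R)%E by rewrite lte_fin.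
    exact: (cvg_cdfy1 X).
  by move=> [M [_ /(_ (M + 1))]] H; exists (M + 1); rewrite /cdf_level_set/= ltW// H// ltrDl.
have : \forall r \near -oo, (cdf X r < tau%:E)%E.
  have /(@open_ereal_lt' R) : (0 < tau%:E :> \bar R)%E by rewrite lte_fin.
  exact: (cvg_cdfNy0 X).
move=> [M [_ /(_ (M - 1))]] H; exists (M - 1) => t; rewrite /cdf_level_set/= => tt.
rewrite leNgt; apply/negP => tM.
have HM : (cdf X (M - 1) < tau%:E)%E by apply: H; rewrite ltrBlDr ltrDl.
by have := le_lt_trans (le_trans tt (cdf_nondecreasing X (ltW tM))) HM; rewrite ltxx.
Qed.

(** The density is at most c, so an interval of length e / c has mass at most e:
    moving q by e / c costs at most e. *)
Lemma quantile_mass_le : (P (X @^-1` `]-oo, q[) <= tau%:E)%E.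
Proof.
apply/lee_addgt0Pr => e e0.
have d0 : 0 < e / c by rewrite divr_gt0.
have -> : `]-oo, q[%classic = `]-oo, q - e / c] `|` `]q - e / c, q[ :> set R.
  by rewrite -itv_bndbnd_setU// bnd_simp; lra.
rewrite preimage_setU (le_trans (measureU2 _ _ _))//; try exact: measurable_preim_RV.
apply: leeD.
  have nq : ~ cdf_level_set (q - e / c).
    by move=> /(ge_inf cdf_level_set_has_inf.2); rewrite -/q => ?; lra.
  by rewrite leNgt; apply/negP => /ltW.
apply: (le_trans (density_le _ pc)) => //.
rewrite lebesgue_measure_itv/= lte_fin ifT; last by lra.
by rewrite -EFinB -EFinM lee_fin opprB addrCA subrr addr0 mulrC divfK// gt_eqF.
Qed.

Lemma quantile_mass_ge : (tau%:E <= P (X @^-1` `]-oo, q]))%E.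
Proof.
apply/lee_addgt0Pr => e e0.
have d0 : 0 < e / c by rewrite divr_gt0.
have [t /= tt tq] : exists2 t, cdf_level_set t & t < q + e / c.
  by apply: inf_adherent => //; exact: cdf_level_set_has_inf.
apply: (le_trans tt); apply: (le_trans (cdf_nondecreasing X (ltW tq))).
rewrite /cdf /distribution /pushforward.
have -> : `]-oo, q + e / c]%classic = `]-oo, q] `|` `]q, q + e / c] :> set R.
  by rewrite -itv_bndbnd_setU// bnd_simp; lra.
rewrite preimage_setU (le_trans (measureU2 _ _ _))//; try exact: measurable_preim_RV.
apply: leeD => //.
apply: (le_trans (density_le _ pc)) => //.
rewrite lebesgue_measure_itv/= lte_fin ifT; last by lra.
by rewrite -EFinB -EFinM lee_fin addrAC subrr add0r mulrC divfK// gt_eqF.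
Qed.

Lemma bounded_mf_loss_diff v u : bounded_mf (fun w => loss_diff tau u v (X w)).
Proof.
split; first exact: measurable_RV_comp (measurable_loss_diff _ _ _).
by exists `|v - u| => w; exact: loss_diff_bound.
Qed.

(** Near the quantile q the density is at least plow, so the expected quantile
    loss grows quadratically in v - q, and then linearly. *)
Lemma expected_loss_margin L0 plow v : 0 < L0 -> 0 < plow ->
  (forall t, `|t| <= L0 -> plow <= p (q + t)) ->
  plow / 4 * Num.min 1 L0 * Dsq (v - q) <= mean P (fun w => loss_diff tau q v (X w)).
Proof.
move=> L00 pl0 plp.
have mX (A : set R) : measurable A -> bounded_mf (fun w => \1_A (X w) : R).
  exact: bounded_mf_indic.
pose s := Num.min (`|v - q| / 2) L0.
have s0 : 0 <= s by rewrite le_min divr_ge0// ltW.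
have sv : s <= `|v - q| / 2 by rewrite ge_min lexx.
have sL : s <= L0 by rewrite ge_min lexx orbT.
have bl : bounded_mf (fun w => loss_diff tau q v (X w)) := bounded_mf_loss_diff v q.
(* The interval of length s next to q lies in the half of the segment from q to v
   that is nearest to q, and in the zone where the density is at least plow. *)
apply: (@le_trans _ _ (`|v - q| / 2 * (plow * s))).
  have m0 : 0 <= Num.min 1 L0 by rewrite le_min ler01 ltW.
  have D0 : 0 <= Dsq (v - q) by rewrite le_min normr_ge0 sqr_ge0.
  have D1 : Dsq (v - q) <= `|v - q| by rewrite ge_min lexx.
  have D2 : Dsq (v - q) <= `|v - q| * `|v - q|.
    by rewrite -normrM -expr2 ger0_norm ?sqr_ge0// ge_min lexx orbT.
  have m1 : Num.min 1 L0 <= 1 by rewrite ge_min lexx.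
  have mL : Num.min 1 L0 <= L0 by rewrite ge_min lexx orbT.
  rewrite (_ : plow / 4 * _ * _ = plow * (Num.min 1 L0 * Dsq (v - q) / 4)); last by ring.
  rewrite (_ : `|v - q| / 2 * (plow * s) = plow * (`|v - q| / 2 * s)); last by ring.
  rewrite ler_pM2l//.
  move: m0 D0 D1 D2 m1 mL; rewrite /s.
  move: (Num.min 1 L0) (Dsq (v - q)) `|v - q| (normr_ge0 (v - q)) => m D a a0 m0 D0 D1 D2 m1 mL.
  have [aL|aL] := leP (a / 2) L0.
    have : m * D <= 1 * (a * a) by apply: ler_pM.
    by lra.
  have : m * D <= L0 * a by apply: ler_pM.
  by nra.
have [qv|vq] := leP q v.
  have I1 : plow * s <= mean P (fun w => \1_(`]q, q + s]) (X w)).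
    rewrite -lee_fin mean_indic//.
    have := @density_ge plow `]q, q + s]%classic.
    rewrite lebesgue_measure_itv/= lte_fin ltrDl.
    have [s1|s1] := ltP 0 s; last first.
      by rewrite mule0 => _; rewrite (_ : s = 0) ?mulr0//; lra.
    rewrite -EFinB -EFinM addrAC subrr add0r; apply => //; first exact: ltW.
    move=> t /=; rewrite in_itv/= => /andP[t1 t2].
    by rewrite -(subrKC q t); apply: plp; rewrite ger0_norm; lra.
  have I2 : tau <= mean P (fun w => \1_(`]-oo, q]) (X w)).
    by rewrite -lee_fin mean_indic//; exact: quantile_mass_ge.
  rewrite ger0_norm in sv *; last lra.
  pose f w := (v - q) * (\1_(`]-oo, q]%classic) (X w) - tau)
              + (v - q) / 2 * \1_(`]q, q + s]%classic) (X w).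
  have b1 : bounded_mf (fun w => \1_(`]-oo, q]%classic) (X w) - tau).
    by apply: bounded_mfB; [exact: mX|exact: bounded_mf_cst].
  apply: (@le_trans _ _ (mean P f)); last first.
    apply: le_mean => //; last by move=> w; apply: loss_diff_ge_right => //; lra.
    by apply: bounded_mfD; apply: bounded_mfZ => //; exact: mX.
  rewrite /f meanD ?meanZ ?meanB ?mean_cst; try by [exact: b1|exact: mX|
    exact: bounded_mf_cst|exact: bounded_mfZ (mX _ _)|exact: bounded_mfZ].
  move: I1 I2; set i1 := mean _ _; set i2 := mean _ _ => I1 I2.
  nra.
have I1 : plow * s <= mean P (fun w => \1_(`[q - s, q[) (X w)).
  rewrite -lee_fin mean_indic//.
  have := @density_ge plow `[q - s, q[%classic.
  rewrite lebesgue_measure_itv/= lte_fin ltrBlDr ltrDl.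
  have [s1|s1] := ltP 0 s; last first.
    by rewrite mule0 => _; rewrite (_ : s = 0) ?mulr0//; lra.
  rewrite -EFinB -EFinM opprB addrCA subrr addr0; apply => //; first exact: ltW.
  move=> t /=; rewrite in_itv/= => /andP[t1 t2].
  by rewrite -(subrKC q t); apply: plp; rewrite ler0_norm; lra.
have I2 : mean P (fun w => \1_(`]-oo, q[) (X w)) <= tau.
  by rewrite -lee_fin mean_indic//; exact: quantile_mass_le.
rewrite ltr0_norm in sv *; last lra.
rewrite opprB in sv *.
pose f w := (q - v) * (tau - \1_(`]-oo, q[%classic) (X w))
            + (q - v) / 2 * \1_(`[q - s, q[%classic) (X w).
have b1 : bounded_mf (fun w => tau - \1_(`]-oo, q[%classic) (X w)).
  by apply: bounded_mfB; [exact: bounded_mf_cst|exact: mX].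
apply: (@le_trans _ _ (mean P f)); last first.
  apply: le_mean => //; last by move=> w; apply: loss_diff_ge_left => //; lra.
  by apply: bounded_mfD; apply: bounded_mfZ => //; exact: mX.
rewrite /f meanD ?meanZ ?meanB ?mean_cst; try by [exact: b1|exact: mX|
    exact: bounded_mf_cst|exact: bounded_mfZ (mX _ _)|exact: bounded_mfZ].
move: I1 I2; set i1 := mean _ _; set i2 := mean _ _ => I1 I2.
nra.
Qed.
End QuantileMargin.

(** * Exponential moments and maxima *)

Section Deviation.
Context {disp : measure_display} {T : measurableType disp} {R : realType}.
Context (P : probability T R).

(** From exp(-x) >= 1 - x, since (1 - x)(1 + x + 2x^2) = 1 + x^2 (1 - 2x)
    is at least 1. *)
Lemma expR_le_quadratic (x : R) : x <= 1 / 2 -> expR x <= 1 + x + 2 * x ^+ 2.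
Proof.
move=> x2; have x1 : 0 < 1 - x by lra.
have := expR_ge1Dx (- x); rewrite expRN => H.
have E : expR x <= (1 - x)^-1.
  by rewrite -[expR x]invrK lef_pV2// posrE ?invr_gt0 ?expR_gt0.
apply: (le_trans E); rewrite -[(1 - x)^-1]mul1r ler_pdivrMr//.
by nra.
Qed.

Lemma mean_expR_le (f : T -> R) (K lam : R) : bounded_mf f -> mean P f = 0 ->
  (forall w, `|f w| <= K) -> 0 <= lam -> lam * K <= 1 / 2 ->
  mean P (fun w => expR (lam * f w)) <= expR (2 * (lam * K) ^+ 2).
Proof.
move=> bf f0 fK lam0 lamK.
have K0 : 0 <= K by apply: le_trans (fK point).
apply: (@le_trans _ _ (1 + 2 * (lam * K) ^+ 2)); last exact: expR_ge1Dx.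
rewrite -(mean_cst P (1 + _)) -[leRHS]addr0 -(mulr0 lam) -f0 -meanZ// -meanD//; first last.
- exact: bounded_mfZ.
- exact: bounded_mf_cst.
apply: le_mean.
- exact/bounded_mf_expR/bounded_mfZ.
- by apply: bounded_mfD; [exact: bounded_mf_cst|exact: bounded_mfZ].
move=> w; have := fK w; rewrite ler_norml => /andP[fK1 fK2].
apply: (le_trans (expR_le_quadratic _)).
  by apply: le_trans lamK; rewrite ler_wpM2l.
rewrite addrAC lerD2r lerD2l ler_pM2l// !exprMn ler_wpM2l ?sqr_ge0//.
by rewrite -[_ ^+ 2]ger0_norm ?sqr_ge0// normrX lerXn2r// nnegrE.
Qed.

Lemma mean_expR_sum_le n (y : 'I_n -> {RV P >-> R}) (h : 'I_n -> R -> R) (K lam : R) :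
  mutually_independent y -> (forall i, measurable_fun [set: R] (h i)) ->
  (forall i t, `|h i t| <= K) -> (forall i, mean P (fun w => h i (y i w)) = 0) ->
  0 <= lam -> lam * K <= 1 / 2 ->
  mean P (fun w => expR (lam * \sum_i h i (y i w))) <= expR (n%:R * (2 * (lam * K) ^+ 2)).
Proof.
move=> yind mh hK h0 lam0 lamK.
have bh i : bounded_mf (fun w => h i (y i w)).
  by split; [exact: measurable_RV_comp|exists K].
have E : mean P (fun w => expR (lam * \sum_i h i (y i w))) =
    \prod_i mean P (fun w => expR (lam * h i (y i w))).
  apply: EFin_inj; rewrite meanE; last exact/bounded_mf_expR/bounded_mfZ/bounded_mf_sum.
  rewrite -prodEFin; under [RHS]eq_bigr => i _ do
    rewrite (meanE P (bounded_mf_expR (bounded_mfZ lam (bh i)))).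
  under eq_integral do rewrite mulr_sumr expR_sum.
  apply: (@indep_integral_prod _ _ _ P n y (fun i t => expR (lam * h i t)) (expR (lam * K))) => //.
    move=> i; apply: (measurableT_comp (@measurable_expR R)).
    exact: measurable_funM.
  move=> i t; rewrite expR_ge0 ler_expR ler_wpM2l//.
  exact: le_trans (ler_norm _) (hK i t).
rewrite E.
have -> : expR (n%:R * (2 * (lam * K) ^+ 2)) = \prod_(i < n) expR (2 * (lam * K) ^+ 2).
  by rewrite prodr_const card_ord -expRM_natl mulr_natl.
apply: ler_prod => i _; rewrite mean_expR_le// andbT.
by apply: Rintegral_ge0 => w _; exact: expR_ge0.
Qed.

(** The envelope is (s - 1 + exp(-s) sum_k exp(lam Z_k)) / lam with
    s = ln N + a; it dominates each Z_k since t <= exp(t - s) + s - 1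
    for t = lam Z_k. *)
Lemma max_envelope N (Z : 'I_N -> T -> R) (lam a : R) : (0 < N)%N -> 0 < lam ->
  (forall k, bounded_mf (Z k)) ->
  (forall k, mean P (fun w => expR (lam * Z k w)) <= expR a) ->
  exists V : T -> R, [/\ bounded_mf V, mean P V <= (ln N%:R + a) / lam
    & forall k w, Z k w <= V w].
Proof.
move=> N0 lam0 bZ Za; pose s := ln N%:R + a.
have bE k : bounded_mf (fun w => expR (lam * Z k w)) by exact/bounded_mf_expR/bounded_mfZ.
have bS := @bounded_mf_sum _ T R _ (index_enum 'I_N) _ bE.
exists (fun w => lam^-1 * (s - 1 + expR (- s) * \sum_k expR (lam * Z k w))); split.
- by apply/bounded_mfZ/bounded_mfD; [exact: bounded_mf_cst|exact: bounded_mfZ].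
- rewrite meanZ; last by apply: bounded_mfD; [exact: bounded_mf_cst|exact: bounded_mfZ].
  rewrite meanD ?mean_cst ?meanZ ?mean_sum//; try by [exact: bounded_mf_cst|exact: bounded_mfZ].
  rewrite mulrC ler_pM2r ?invr_gt0// -/s.
  have : \sum_k mean P (fun w => expR (lam * Z k w)) <= expR s.
    apply: (@le_trans _ _ (\sum_(k < N) expR a)); first exact: ler_sum.
    by rewrite sumr_const card_ord /s expRD lnK ?posrE ?ltr0n// mulr_natl.
  move/(ler_wpM2l (expR_ge0 (- s))); rewrite -expRD addNr expR0; lra.
- move=> k w; rewrite mulrC ler_pdivlMr// mulrC.
  apply: (@le_trans _ _ (s - 1 + expR (lam * Z k w - s))).
    by have := expR_ge1Dx (lam * Z k w - s); lra.
  rewrite lerD2l addrC expRD ler_wpM2l ?expR_ge0// (bigD1 k)//= lerDl.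
  by apply: sumr_ge0 => i _; exact: expR_ge0.
Qed.

Lemma mean_copy (X Y : {RV P >-> R}) (h : R -> R) :
  (forall A : set R, measurable A -> P (X @^-1` A) = P (Y @^-1` A)) ->
  measurable_fun [set: R] h -> bounded_mf (fun w => h (X w)) ->
  bounded_mf (fun w => h (Y w)) ->
  mean P (fun w => h (X w)) = mean P (fun w => h (Y w)).
Proof.
move=> XY mh bX bY; apply: EFin_inj; rewrite !meanE//.
have mh' : measurable_fun [set: R] (EFin \o h) by exact/measurable_EFinP.
rewrite -[LHS](integral_distribution mh' (bounded_mf_integrable P bX)).
rewrite -[RHS](integral_distribution mh' (bounded_mf_integrable P bY)).
by apply: eq_measure_integral => A mA _; exact: XY.
Qed.

(** Only the equality of the marginal laws is extracted from the copy. *)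
Lemma independent_copy_marginal n (y z : 'I_n -> {RV P >-> R}) i (A : set R) :
  independent_copy y z -> measurable A -> P (z i @^-1` A) = P (y i @^-1` A).
Proof.
move=> [yz _] mA.
have mB : measurable [set u : n.-tuple R | A (tnth u i)].
  by rewrite -[X in measurable X]setTI; exact: (@measurable_tnth _ _ _ i measurableT A mA).
have := yz _ mB; rewrite /joint.
have E (u : 'I_n -> {RV P >-> R}) :
    (fun w => [tuple u i w | i < n]) @^-1` [set u : n.-tuple R | A (tnth u i)] = u i @^-1` A.
  by apply/seteqP; split => w /=; rewrite tnth_mktuple.
by rewrite !E.
Qed.

End Deviation.

(** * Uniform deviation of the excess loss *)

Section ExcessLoss.
Context {R : realType}.

Lemma rate_sq (n W U L : nat) : (0 < n)%N -> (0 < U)%N ->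
  n%:R * (rate n W U L : R) ^+ 2 = L%:R * W%:R * ln U%:R * ln n%:R.
Proof.
move=> n0 U0; have n0' : 0 < n%:R :> R by rewrite ltr0n.
rewrite /rate sqr_sqrtr; first by rewrite mulrC divfK// gt_eqF.
by rewrite !mulr_ge0 ?ler0n// ?invr_ge0 ?ler0n// ln_ge0// ler1n.
Qed.

Lemma rate_ge0 (n W U L : nat) : 0 <= rate n W U L :> R.
Proof. exact: sqrtr_ge0. Qed.

Lemma ln2_gt0 : 0 < ln 2 :> R.
Proof. by rewrite ln_gt0// ltr1n. Qed.

Lemma ln_nat_ge (n : nat) : (1 < n)%N -> ln 2 <= ln n%:R :> R.
Proof. by move=> n1; rewrite ler_ln ?posrE ?ltr0n ?ler_nat//; lia. Qed.

(** The logarithm is 9WL (ln n + ln U), and ln n + ln U <= 2 / ln 2 * ln n * ln U. *)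
Lemma log_cover_bound (n W U L : nat) : (1 < n)%N -> (1 < U)%N ->
  ln ((n * U) ^ (9 * W * L))%:R <= 18 / ln 2 * (n%:R * (rate n W U L : R) ^+ 2).
Proof.
move=> n1 U1; rewrite rate_sq ?(ltnW n1) ?(ltnW U1)//.
have l2 := ln2_gt0; have ln_n := ln_nat_ge n1; have ln_U := ln_nat_ge U1.
have n0 : (0 < n)%N by lia. have U0 : (0 < U)%N by lia.
rewrite natrX lnXn ?ltr0n ?muln_gt0 ?n0// natrM lnM ?posrE ?ltr0n//.
rewrite -[leLHS]mulr_natl !natrM.
rewrite [leRHS](_ : _ = 9 * W%:R * L%:R * (2 / ln 2 * (ln U%:R * ln n%:R))); last by ring.
rewrite ler_wpM2l ?mulr_ge0 ?ler0n//.
rewrite mulrAC ler_pdivlMr//; move: l2 ln_n ln_U.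
by move: (ln 2) (ln n%:R) (ln U%:R) => a b c a0 ab ac; nra.
Qed.

Lemma rate_ge (n W U L : nat) : (1 < n)%N -> (1 < U)%N -> (0 < L)%N -> (0 < W)%N ->
  ln 2 <= n%:R * (rate n W U L : R).
Proof.
move=> n1 U1 L0 W0; have l2 := ln2_gt0.
have ln_n := ln_nat_ge n1; have ln_U := ln_nat_ge U1.
have n0 : 0 <= n%:R :> R by rewrite ler0n.
have : (ln 2 : R) ^+ 2 <= (n%:R * rate n W U L) ^+ 2.
  have n1' : 1 <= n%:R * (L%:R * W%:R) :> R.
    by rewrite -!natrM ler1n !muln_gt0 L0 W0 !andbT; lia.
  have -> : (n%:R * rate n W U L) ^+ 2 =
      n%:R * (L%:R * W%:R) * (ln U%:R * ln n%:R) :> R.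
    rewrite exprMn [n%:R ^+ 2]expr2 -mulrA rate_sq; [ring|lia|lia].
  move: l2 ln_n ln_U n1'; move: (n%:R * (L%:R * W%:R)) (ln 2) (ln n%:R) (ln U%:R) => m a b c.
  move=> a0 ab ac m1.
  have bc : a * a <= c * b by apply: ler_pM => //; exact: ltW.
  by rewrite expr2; nra.
by rewrite ler_pXn2r// nnegrE ?mulr_ge0 ?rate_ge0 ?ler0n// ltW.
Qed.

Lemma loss_diff_chain (tau q g v t : R) :
  loss_diff tau q v t = loss_diff tau g v t + loss_diff tau q g t.
Proof. by rewrite /loss_diff; ring. Qed.

Context {disp : measure_display} {T : measurableType disp}.
Context (P : probability T R).

(** A random variable V dominating, for each function f of the class that fits
    the sample at least as well as g, the average expected excess loss of f
    over g. *)
Lemma excess_loss_envelope d (tau F : R) (n W U L : nat) (x : 'I_n -> 'cV[R]_d)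
    (y : 'I_n -> {RV P >-> R}) (g : 'cV[R]_d -> R) :
  0 < tau < 1 -> 0 < F -> (0 < n)%N -> mutually_independent y ->
  bounded_relu_class W U L F g ->
  2 / ln 2 * (L%:R * W%:R * ln U%:R) <= n%:R :> R ->
  exists V : T -> R, [/\ bounded_mf V,
    mean P V <= (146 / ln 2 + 4) * F * rate n W U L
    & forall w f, bounded_relu_class W U L F f ->
      \sum_i quantile_loss tau (y i w - f (x i)) <=
      \sum_i quantile_loss tau (y i w - g (x i)) ->
      n%:R^-1 * \sum_i mean P (fun w' => loss_diff tau (g (x i)) (f (x i)) (y i w'))
        <= V w].
Proof.
move=> tau01 F0 n0 yind gF nC.
have l2 := ln2_gt0; have n0' : 0 < n%:R :> R by rewrite ltr0n.
have A2 : 2 <= 146 / ln 2 + 4 :> R.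
  suff : 0 < 146 / ln 2 :> R by lra.
  by rewrite divr_gt0.
have bl i a b : bounded_mf (fun w => loss_diff tau a b (y i w)).
  exact: bounded_mf_loss_diff.
(* Without hidden layer the class only contains 0. *)
case: L => [|L] in gF nC *.
  exists (fun=> 0); split; first exact: bounded_mf_cst.
    by rewrite mean_cst !mulr_ge0 ?rate_ge0//; lra.
  move=> w f fF _; rewrite big1 ?mulr0// => i _.
  rewrite (bounded_relu_class0 _ gF) (bounded_relu_class0 _ fF) /loss_diff.
  by under eq_fun do rewrite subrr; rewrite mean_cst.
have /andP[W0 LU] := relu_class_sizes gF.1 (ltn0Sn L).
have U1 : (1 < U)%N by lia.
(* For n = 1 the sample size condition fails, since 2 / ln 2 * ln U >= 2. *)
have [n1|n1] := leqP n 1.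
  have n1' : n%:R <= 1 :> R by rewrite -[1]/(1%:R) ler_nat.
  have LW1 : 1 <= L.+1%:R * W%:R :> R by rewrite -natrM ler1n muln_gt0 W0.
  have H : 2 / ln 2 * (1 * ln 2) <= 2 / ln 2 * (L.+1%:R * W%:R * ln U%:R) :> R.
    by rewrite ler_pM2l ?divr_gt0//; apply: ler_pM => //; [exact: ltW|exact: ln_nat_ge].
  have := le_trans H (le_trans nC n1'); rewrite mul1r divfK ?gt_eqF//; lra.
have gb j : `|g (x j)| <= F by exact: supnorm_le_pointwise gF.2.
(* Above rate 1, the bound 2F on the excess loss suffices. *)
have [r1|r1] := ltP 1 (rate n W U L.+1 : R).
  exists (fun=> 2 * F); split; first exact: bounded_mf_cst.
    rewrite mean_cst (@le_trans _ _ (2 * F * rate n W U L.+1))//.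
      by rewrite ler_peMr ?mulr_ge0 ?ltW.
    by rewrite -!mulrA ler_wpM2r// mulr_ge0 ?rate_ge0// ltW.
  move=> w f fF _; have fb j : `|f (x j)| <= F by exact: supnorm_le_pointwise fF.2.
  rewrite ler_pdivrMl// (_ : n%:R * _ = \sum_(i < n) 2 * F); last first.
    by rewrite sumr_const card_ord mulr_natl.
  apply: ler_sum => i _.
  apply: (le_trans (ler_norm _)); apply: mean_le_bound => // w'.
  apply: (le_trans (loss_diff_bound _ _ _ tau01)); apply: (le_trans (ler_normB _ _)).
  by rewrite mulr2n mulrDl mul1r lerD.
have [v [vF vcover]] := network_cover x n1 (ltn0Sn L) F0 gF.1.
set N := ((n * U) ^ _)%N in v vF vcover.
(* h k i is the centred loss increment, expected minus observed. *)
pose h k i t := mean P (fun w => loss_diff tau (g (x i)) (v k i) (y i w))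
  - loss_diff tau (g (x i)) (v k i) t.
have ldF i k t : `|loss_diff tau (g (x i)) (v k i) t| <= 2 * F.
  apply: (le_trans (loss_diff_bound _ _ _ tau01)); apply: (le_trans (ler_normB _ _)).
  by rewrite mulr2n mulrDl mul1r lerD.
have hK k i t : `|h k i t| <= 4 * F.
  apply: (le_trans (ler_normB _ _)).
  have : `|mean P (fun w => loss_diff tau (g (x i)) (v k i) (y i w))| <= 2 * F.
    by apply: mean_le_bound => // w.
  by have := ldF i k t; lra.
have h0 k i : mean P (fun w => h k i (y i w)) = 0.
  by rewrite meanB ?mean_cst ?subrr//; exact: bounded_mf_cst.
have mh k i : measurable_fun [set: R] (h k i).
  by apply: measurable_funB => //; exact: measurable_loss_diff.
have bh k i : bounded_mf (fun w => h k i (y i w)).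
  by apply: bounded_mfB => //; exact: bounded_mf_cst.
set r := rate n W U L.+1 in r1 *.
have lnr := rate_ge n1 U1 (ltn0Sn L) W0; rewrite -/r in lnr.
have r0 : 0 < r by rewrite -(pmulr_rgt0 _ n0') (lt_le_trans l2).
(* This choice balances ln N <= (18 / ln 2) n r^2 against the exponential
   moment term, and r <= 1 ensures lam * 4F <= 1/2. *)
pose lam := r / (8 * F).
have lam0 : 0 < lam by rewrite divr_gt0// mulr_gt0.
have lamK : lam * (4 * F) = r / 2 by rewrite /lam; field; rewrite gt_eqF.
have N0 : (0 < N)%N by rewrite expn_gt0 muln_gt0 n0; apply/orP; left; lia.
have [V [bV mV ZV]] := max_envelope (Z := fun k w => \sum_i h k i (y i w)) N0 lam0
  (fun k => bounded_mf_sum _ (bh k))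
  (fun k => mean_expR_sum_le yind (mh k) (hK k) (h0 k) (ltW lam0) ltac:(rewrite lamK; lra)).
(* The two terms F account for the passage from f to the cover, in the expected
   and in the observed loss. *)
exists (fun w => n%:R^-1 * (2 * F + V w)); split.
- by apply/bounded_mfZ/bounded_mfD => //; exact: bounded_mf_cst.
- rewrite meanZ; last by apply: bounded_mfD => //; exact: bounded_mf_cst.
  rewrite meanD ?mean_cst//; last exact: bounded_mf_cst.
  rewrite ler_pdivrMl//.
  have := log_cover_bound W L.+1 n1 U1; rewrite -/r => lnN.
  have mV' : mean P V <= (18 / ln 2 * (n%:R * r ^+ 2) + n%:R * (2 * (r / 2) ^+ 2)) / lam.
    by apply: (le_trans mV); rewrite lamK ler_pM2r ?invr_gt0// lerD2r.
  have E : (18 / ln 2 * (n%:R * r ^+ 2) + n%:R * (2 * (r / 2) ^+ 2)) / lam =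
      (144 / ln 2 + 4) * F * (n%:R * r).
    by rewrite /lam; field; rewrite !gt_eqF.
  have F2 : 2 * F <= 2 / ln 2 * F * (n%:R * r).
    rewrite (_ : 2 / ln 2 * F * _ = 2 * F * (n%:R * r / ln 2)); last by ring.
    have H : 1 <= n%:R * r / ln 2 by rewrite ler_pdivlMr// mul1r.
    by apply: ler_peMr => //; lra.
  rewrite E in mV'; rewrite (_ : n%:R * _ = 2 / ln 2 * F * (n%:R * r)
    + (144 / ln 2 + 4) * F * (n%:R * r)); last by ring.
  exact: lerD.
- move=> w f fF ffit; have [k fk] := vcover f fF.
  rewrite ler_pM2l ?invr_gt0//.
  have := ZV k w; rewrite /h sumrB => ZVk.
  have D1 : \sum_i mean P (fun w' => loss_diff tau (g (x i)) (f (x i)) (y i w')) <=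
      \sum_i mean P (fun w' => loss_diff tau (g (x i)) (v k i) (y i w')) + F.
    have -> : F = \sum_(i < n) F / n%:R.
      by rewrite sumr_const card_ord -[RHS]mulr_natr divfK// gt_eqF.
    rewrite -big_split/=; apply: ler_sum => i _.
    rewrite -lerBlDl -meanB//; apply: (le_trans (ler_norm _)); apply: mean_le_bound.
      exact: bounded_mfB.
    move=> w'; apply: le_trans (fk i); rewrite /loss_diff opprB addrA subrK.
    by apply: (le_trans (loss_diff_bound _ _ _ tau01)).
  have D2 : \sum_i loss_diff tau (g (x i)) (v k i) (y i w) <=
      \sum_i loss_diff tau (g (x i)) (f (x i)) (y i w) + F.
    have -> : F = \sum_(i < n) F / n%:R.
      by rewrite sumr_const card_ord -[RHS]mulr_natr divfK// gt_eqF.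
    rewrite -big_split/=; apply: ler_sum => i _.
    rewrite -lerBlDl; apply: (le_trans (ler_norm _)).
    rewrite distrC; apply: le_trans (fk i); rewrite /loss_diff opprB addrA subrK.
    by apply: (le_trans (loss_diff_bound _ _ _ tau01)).
  have D3 : \sum_i loss_diff tau (g (x i)) (f (x i)) (y i w) <= 0.
    by rewrite sumrB subr_le0.
  lra.
Qed.
End ExcessLoss.

(** * The oracle inequality *)

Section LossComparison.
Context {R : realType}.
Implicit Types t a : R.

Lemma DsqN t : Dsq (- t) = Dsq t.
Proof. by rewrite /Dsq normrN sqrrN. Qed.

Lemma Dsq_ge0 t : 0 <= Dsq t.
Proof. by rewrite /Dsq le_min normr_ge0 sqr_ge0. Qed.

Lemma Dsq_le_norm t : Dsq t <= `|t|.
Proof. by rewrite /Dsq ge_min lexx. Qed.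

Lemma measurable_Dsq : measurable_fun [set: R] (@Dsq R).
Proof. by apply: measurable_minr; [exact: normr_measurable|exact: measurable_funX]. Qed.

Lemma sqr_le_Dsq t a : `|t| <= a -> t ^+ 2 <= Num.max 1 a * Dsq t.
Proof.
move=> ta; have m1 : 1 <= Num.max 1 a by rewrite le_max lexx.
have ma : `|t| <= Num.max 1 a by rewrite le_max ta orbT.
have tt : t ^+ 2 = `|t| * `|t| by rewrite -normrM -expr2 ger0_norm// sqr_ge0.
rewrite /Dsq tt; have t0 := normr_ge0 t.
case: (leP `|t| (`|t| * `|t|)) => _; first by rewrite ler_wpM2r.
by rewrite ler_peMl// mulr_ge0.
Qed.

End LossComparison.

Theorem theorem1 (R : realType) (d : nat) (tau F L0 plow c B : R)
    (htau : 0 < tau < 1) (hF : 0 < F)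
    (hL0 : 0 < L0) (hplow : 0 < plow) (hc : 0 < c) :
  exists C c1 : R, 0 < C /\ 0 < c1 /\
  forall (n W U L : nat) (x : 'I_n -> 'cV[R]_d)
    (disp : measure_display) (T : measurableType disp) (P : probability T R)
    (y z : 'I_n -> {RV P >-> R}) (p : 'I_n -> R -> R)
    (fstar : 'cV[R]_d -> R)
    (fhat : T -> 'cV[R]_d -> R) (fn : 'cV[R]_d -> R),
    (0 < n)%N ->
    mutually_independent y ->
    (forall i, is_density (y i) (p i)) ->
    (forall i, fstar (x i) = quantile (y i) tau) ->
    (forall delta : 'rV[R]_n, `|delta| <= L0 ->
       forall i, plow <= p i (fstar (x i) + delta 0 i)) ->
    (forall i t, p i t <= c) ->
    (forall w, is_argmin (bounded_relu_class W U L F)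
       (fun f : 'cV[R]_d -> R =>
          \sum_(i < n) quantile_loss tau (y i w - f (x i))) (fhat w)) ->
    (forall i, measurable_fun [set: T] (fun w => fhat w (x i))) ->
    independent_copy y z ->
    is_argmin (bounded_relu_class W U L F)
      (fun f : 'cV[R]_d -> R => 'E_P[excess_loss x tau z fstar f]%E) fn ->
    C * (L%:R * W%:R * ln U%:R) <= n%:R ->
    ('E_P[fun w => Delta2 x fstar (fhat w)] <=
       (c1 * F * rate n W U L)%:E + c1%:E * err1 x tau z fstar fn)%E /\
    ((forall i, `|fstar (x i)| <= B) ->
     ('E_P[fun w => empnorm2 x (fhat w) fstar] <=
       (c1 * Num.max 1 F * F * rate n W U L)%:E
       + (c1 * Num.max 1 F)%:E * err1 x tau z fstar fn)%E).
Proof.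
have l2 := @ln2_gt0 R; have m0 : 0 < Num.min 1 L0 by rewrite lt_min ltr01.
(* c0 is the margin constant, A the constant of the envelope and M converts D^2
   into squares. *)
pose c0 := plow / 4 * Num.min 1 L0.
have c00 : 0 < c0 by rewrite mulr_gt0// divr_gt0.
pose A : R := 146 / ln 2 + 4; pose M := Num.max 1 (F + `|B|).
have A1 : 1 <= A.
  suff : 0 < 146 / ln 2 :> R by rewrite /A; lra.
  by rewrite divr_gt0.
have M1 : 1 <= M by rewrite le_max lexx.
have c10 : 0 < M * (A / c0) by rewrite mulr_gt0 ?divr_gt0//; lra.
exists (2 / ln 2), (M * (A / c0)); split; first by rewrite divr_gt0.
split=> // n W U L x disp T P y z p fstar fhat fn n0 yind yp fq pl pc fhatP mfhat yz [fnF _] nC.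
have n0' : 0 < n%:R :> R by rewrite ltr0n.
have plq i t : `|t| <= L0 -> plow <= p i (quantile (y i) tau + t).
  move=> tL; have := pl (const_mx t) _ i; rewrite mxE -fq; apply.
  rewrite [leLHS]mx_normrE; apply/bigmax_leP; split; first exact: ltW.
  by move=> ij _; rewrite mxE.
have bl i a b : bounded_mf (fun w => loss_diff tau a b (y i w)).
  exact: bounded_mf_loss_diff.
have margin i v : c0 * Dsq (v - fstar (x i)) <=
    mean P (fun w => loss_diff tau (fstar (x i)) v (y i w)).
  rewrite fq; apply: (@expected_loss_margin _ _ _ P _ _ (yp i) tau c htau hc (pc i)) => //.
  by move=> t; exact: plq.
pose e1 : R := n%:R^-1 * \sum_i mean P (fun w => loss_diff tau (fstar (x i)) (fn (x i)) (y i w)).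
have e10 : 0 <= e1.
  rewrite mulr_ge0 ?invr_ge0 ?ler0n//; apply: sumr_ge0 => i _.
  by apply: le_trans (margin i _); rewrite mulr_ge0 ?Dsq_ge0// ltW.
(* err1 is written with the copy z, the rest with y. *)
have blz i a b : bounded_mf (fun w => loss_diff tau a b (z i w)).
  exact: bounded_mf_loss_diff.
have err1E : err1 x tau z fstar fn = e1%:E.
  rewrite /err1 (_ : (fun w => _) = (fun w => n%:R^-1 *
      \sum_i loss_diff tau (fstar (x i)) (fn (x i)) (z i w))); last first.
    by apply/funext => w; rewrite -mulrBr -sumrB.
  rewrite expectation_mean; last exact/bounded_mfZ/bounded_mf_sum.
  rewrite meanZ; last exact: bounded_mf_sum.
  rewrite mean_sum//; congr (_ * _)%:E; apply: eq_bigr => i _.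
  apply: (@mean_copy _ _ _ P (z i) (y i)
    (loss_diff tau (fstar (x i)) (fn (x i)))) => //; last exact: measurable_loss_diff.
  by move=> D mD; exact: independent_copy_marginal yz mD.
have [V [bV mV VP]] := @excess_loss_envelope R _ _ P d tau F n W U L x y fn htau hF n0 yind fnF nC.
have fF w : bounded_relu_class W U L F (fhat w) := (fhatP w).1.
have fb w i : `|fhat w (x i)| <= F by exact: supnorm_le_pointwise (fF w).2.
have key w : c0 * Delta2 x fstar (fhat w) <= V w + e1.
  have := VP w _ (fF w) ((fhatP w).2 _ fnF) => Vw.
  apply: (@le_trans _ _ (n%:R^-1 * \sum_i mean P (fun w' =>
      loss_diff tau (fstar (x i)) (fhat w (x i)) (y i w')))).
    rewrite /Delta2 mulrCA ler_pM2l ?invr_gt0// mulr_sumr; apply: ler_sum => i _.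
    by rewrite -DsqN opprB.
  apply: le_trans (lerD Vw (lexx e1)).
  rewrite /e1 -mulrDr ler_pM2l ?invr_gt0// -big_split/=; apply: ler_sum => i _.
  rewrite -meanD//; under eq_fun do rewrite (loss_diff_chain _ _ (fn (x i))).
  exact: lexx.
(* Only the expectation of the pointwise bound remains to be taken. *)
have bdiff i : bounded_mf (fun w => fstar (x i) - fhat w (x i)).
  apply: bounded_mfB; first exact: bounded_mf_cst.
  by split; [exact: mfhat|exists F].
have bD : bounded_mf (fun w => Delta2 x fstar (fhat w)).
  apply/bounded_mfZ/bounded_mf_sum => i; have [md [b db]] := bdiff i; split.
    exact: measurableT_comp measurable_Dsq md.
  exists b => w; rewrite ger0_norm ?Dsq_ge0//.
  exact: le_trans (Dsq_le_norm _) (db w).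
have bVe : bounded_mf (fun w => V w + e1) by apply: bounded_mfD => //; exact: bounded_mf_cst.
have r0 : 0 <= rate n W U L :> R by exact: rate_ge0.
have mD : mean P (fun w => Delta2 x fstar (fhat w)) <= A / c0 * (F * rate n W U L + e1).
  have H : c0 * mean P (fun w => Delta2 x fstar (fhat w)) <= A * F * rate n W U L + e1.
    rewrite -meanZ//; apply: (@le_trans _ _ (mean P (fun w => V w + e1))).
      by apply: le_mean => //; exact: bounded_mfZ.
    by rewrite meanD ?mean_cst ?lerD2r//; exact: bounded_mf_cst.
  rewrite mulrAC ler_pdivlMr// mulrC; apply: (le_trans H).
  by rewrite mulrDr mulrA lerD2l ler_peMl.
have Ac0 : 0 <= A / c0 by rewrite divr_ge0 ?ltW//; lra.
have Fr0 : 0 <= F * rate n W U L + e1 by rewrite addr_ge0// mulr_ge0// ltW.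
split.
  rewrite expectation_mean// err1E -EFinM -EFinD lee_fin; apply: (le_trans mD).
  rewrite [leRHS](_ : _ = M * (A / c0 * (F * rate n W U L + e1))); last by ring.
  by rewrite ler_peMl// mulr_ge0.
move=> fB; have m1 : 1 <= Num.max 1 F by rewrite le_max lexx.
have bE : bounded_mf (fun w => empnorm2 x (fhat w) fstar).
  apply/bounded_mfZ/bounded_mf_sum => i.
  have := bounded_mfM (bdiff i) (bdiff i).
  by under eq_fun do rewrite -expr2 -sqrrN opprB.
rewrite expectation_mean// err1E -EFinM -EFinD lee_fin.
apply: (@le_trans _ _ (M * mean P (fun w => Delta2 x fstar (fhat w)))).
  rewrite -meanZ//; apply: le_mean => //; first exact: bounded_mfZ.
  move=> w; rewrite /empnorm2 /Delta2 mulrCA ler_pM2l ?invr_gt0// mulr_sumr.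
  apply: ler_sum => i _; rewrite -[in leRHS]DsqN opprB; apply: sqr_le_Dsq.
  apply: (le_trans (ler_normB _ _)); apply: lerD => //.
  exact: le_trans (fB i) (ler_norm B).
have M0 : 0 <= M by lra.
apply: (le_trans (ler_wpM2l M0 mD)).
rewrite [leRHS](_ : _ = Num.max 1 F * (M * (A / c0) * (F * rate n W U L + e1))); last by ring.
by rewrite [leLHS]mulrA ler_peMl// mulr_ge0// mulr_ge0.
Qed.
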